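(* Let $A$ and $B$ be finitely generated residually finite discrete groups and let $G=A\star B$ be their free product, endowed with a proper length function $\ell$. If $A$ and $B$ are amenable, then $G$ admits a box space which coarsely embeds into a Hilbert space; that is, there exists a sequence $\mathcal N=(N_n)_n$ of finite index normal subgroups of $G$ with trivial intersection such that the box space $\Box_{\mathcal N}G$ coarsely embeds into a Hilbert space.
   Context: Length functions: a length function on a group $G$ is a map $\ell:G\to[0,\infty)$ with $\ell(gh)\le\ell(g)+\ell(h)$, $\ell(g)=\ell(g^{-1})$, and $\ell(g)=0$ iff $g=e$. It is proper if all balls $\{g:\ell(g)\le R\}$ are finite. The associated left-invariant metric is $d(g,h)=\ell(g^{-1}h)$. For a normal subgroup $N$ of $G$, the quotient length on $G/N$ is $\ell_{G/N}(gN)=\inf_{h\in N}\ell(gh)$. Coarse embedding: a metric space $X$ coarsely embeds into a metric space $Y$ if there are a map $F:X\to Y$ and non-decreasing proper functions $\rho_\pm:[0,\infty)\to[0,\infty)$ (proper: tending to infinity at infinity) with $\rho_-(d_X(x,x'))\le d_Y(F(x),F(x'))\le\rho_+(d_X(x,x'))$ for all $x,x'\in X$. Coarse disjoint union: let $d_{\mathrm{f.a}}(n,m)=|2^n-2^m|$ on $\mathbb N$. The coarse disjoint union $\sqcup_nX_n$ of a sequence of metric spaces $(X_n)_n$ is the metric space $(X,d)$, unique up to coarse equivalence, such that: (1) there are a map $p:X\to\mathbb N$ and a non-decreasing proper function $\rho:[0,\infty)\to[0,\infty)$ such that $p^{-1}(n)$ is isometric to $X_n$ for all $n$ and $d_{\mathrm{f.a}}(p(x),p(y))\le\rho(d(x,y))$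 for all $x,y\in X$; (2) for all $R>0$ and $n\ne m$, the set $\{x\in X_n: d(x,X_m)\le R\}$ is bounded. Box space: for a residually finite group $G$ with proper length $\ell$ and a sequence $\mathcal N=(N_n)_n$ of finite index normal subgroups with trivial intersection, $\Box_{\mathcal N}G=\sqcup_nG/N_n$, each $G/N_n$ carrying the quotient length metric. (Up to coarse equivalence it does not depend on $\ell$.) *)

(* Defs.v *)
From HB Require Import structures.
From mathcomp Require Import all_boot all_order all_algebra.
From mathcomp Require Import all_classical all_reals all_analysis.

Set Implicit Arguments.
Unset Strict Implicit.
Unset Printing Implicit Defensive.

Import Order.TTheory GRing.Theory Num.Theory.
Import numFieldNormedType.Exports.

Local Open Scope classical_set_scope.
Local Open Scope ring_scope.

(* Discrete, possibly infinite, groups are MathComp's [groupType]s. *)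

Definition is_subgroup (G : groupType) (H : set G) : Prop :=
  H 1%g /\ forall x y, H x -> H y -> H (x * y^-1)%g.

Definition finitely_generated (G : groupType) : Prop :=
  exists2 S : set G, finite_set S & smallest (@is_subgroup G) S = setT.

Definition lcoset (G : groupType) (N : set G) (g : G) : set G :=
  [set (g * x)%g | x in N].

Definition lcosets (G : groupType) (N : set G) : set (set G) :=
  range (lcoset N).

Record finIndexNormal (G : groupType) := FinIndexNormal {
  fin_set :> set G;
  fin_subgroup : is_subgroup fin_set;
  fin_normal : forall g x, fin_set x -> fin_set (x ^ g)%g;
  fin_index : finite_set (lcosets fin_set) }.

Definition residually_finite (G : groupType) : Prop :=
  forall g : G, g <> 1%g -> exists N : finIndexNormal G, ~ (N : set G) g.

(* von Neumann's definition: a left-invariant finitely additive probability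
   measure defined on all subsets of G. *)
Definition amenable (R : realType) (G : groupType) : Prop :=
  exists mu : set G -> R,
  [/\ forall S, 0 <= mu S,
      mu setT = 1,
      forall S T, S `&` T = set0 -> mu (S `|` T) = mu S + mu T &
      forall g S, mu (lcoset S g) = mu S].

(* G, with the two given morphisms, is the coproduct of A and B in the category
   of groups. *)
Definition is_free_product (A B G : groupType)
    (iA : {multiplicative A -> G}) (iB : {multiplicative B -> G}) : Prop :=
  forall (K : groupType)
    (f : {multiplicative A -> K}) (g : {multiplicative B -> K}),
  exists h : {multiplicative G -> K},
  [/\ h \o iA =1 f, h \o iB =1 g &
      forall h' : {multiplicative G -> K},
        h' \o iA =1 f -> h' \o iB =1 g -> h' =1 h].

Definition is_length (R : realType) (G : groupType) (l : G -> R) : Prop :=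
  [/\ forall g, 0 <= l g,
      forall g h, l (g * h)%g <= l g + l h,
      forall g, l (g^-1)%g = l g &
      forall g, l g = 0 <-> g = 1%g].

Record properLength (R : realType) (G : groupType) := ProperLength {
  len :> G -> R;
  len_length : is_length len;
  len_proper : forall r, finite_set [set g | len g <= r] }.

(* For C = gN this is the infimum of l (gh) over h in N. *)
Definition quotient_length (R : realType) (G : groupType) (l : G -> R)
  (C : set G) : R := inf [set l g | g in C].

(* The length of the coset X^-1 Y in G/N. *)
Definition quotient_dist (R : realType) (G : groupType) (l : G -> R)
    (X Y : set G) : R :=
  quotient_length l [set (x^-1 * y)%g | x in X & y in Y].

(* The metric space G/N; its points are the cosets of N.  The length is a
   parameter of the type so that the metric can be inferred. *)
Definition quotient_space (R : realType) (G : groupType)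
    (l : properLength R G) (N : finIndexNormal G) : Type :=
  {X : set G | X \in lcosets N}.

Section QuotientMetric.
Context (R : realType) (G : groupType).
Implicit Types (l : properLength R G) (N : finIndexNormal G) (X Y Z : set G).

Lemma subgroupM (H : set G) x y : is_subgroup H -> H x -> H y -> H (x * y)%g.
Proof.
move=> [H1 HV] Hx Hy; rewrite -[y]invgK; apply: (HV) => //.
by rewrite -[(y^-1)%g]mul1g; apply: HV.
Qed.

Lemma subgroupV (H : set G) x : is_subgroup H -> H x -> H (x^-1)%g.
Proof. by move=> [H1 HV] Hx; rewrite -[(x^-1)%g]mul1g; apply: HV. Qed.

Lemma lcosetsP N X x y :
  lcosets N X -> X x -> X y <-> (N : set G) (x^-1 * y)%g.
Proof.
have gN := fin_subgroup N.
move=> [g _ <-] [n Nn <-]; split=> [[m Nm <-]|Nxy].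
  rewrite invgM -mulgA mulKg.
  by apply: subgroupM Nm => //; apply: subgroupV.
exists (n * ((g * n)^-1 * y))%g; first exact: subgroupM.
by rewrite mulgA mulVKg.
Qed.

Lemma lcosets_neq0 N X : lcosets N X -> X !=set0.
Proof.
by move=> [g _ <-]; exists (g * 1)%g, 1%g => //; case: (fin_subgroup N).
Qed.

Lemma lcosets_eq N X Y x : lcosets N X -> lcosets N Y -> X x -> Y x -> X = Y.
Proof.
move=> NX NY Xx Yx; apply/seteqP; split=> y.
  by move/(lcosetsP _ NX Xx)/(lcosetsP _ NY Yx).
by move/(lcosetsP _ NY Yx)/(lcosetsP _ NX Xx).
Qed.

Lemma lcoset_divE N (g h : G) :
  [set (x^-1 * y)%g | x in lcoset N g & y in lcoset N h] =
  lcoset N (g^-1 * h)%g.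
Proof.
have gN := fin_subgroup N; apply/seteqP; split=> z.
  move=> [_ [n Nn <-]] [_ [m Nm <-]] <-.
  exists ((n^-1) ^ (g^-1 * h) * m)%g.
    by apply: subgroupM => //; apply: fin_normal; apply: subgroupV.
  by rewrite /conjg !invgM !invgK !mulgA mulgK mulVg mul1g.
move=> [n Nn <-]; exists (g * 1)%g; first by exists 1%g => //; case: gN.
by exists (h * n)%g; [exists n|rewrite mulg1 mulgA].
Qed.

Lemma quotient_distE l N (g h : G) :
  quotient_dist l (lcoset N g) (lcoset N h) =
  inf [set l (g^-1 * h * k)%g | k in N].
Proof.
rewrite /quotient_dist /quotient_length lcoset_divE; congr inf.
apply/seteqP; split=> r /=; first by move=> [_ [k Nk <-] <-]; exists k.
by move=> [k Nk <-]; exists (g^-1 * h * k)%g => //; exists k.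
Qed.

Let values l X Y := [set l g | g in [set (x^-1 * y)%g | x in X & y in Y]].

Let values_has_inf l N X Y : lcosets N X -> lcosets N Y ->
  has_inf (values l X Y).
Proof.
move=> /lcosets_neq0[x Xx] /lcosets_neq0[y Yy]; split.
  by exists (l (x^-1 * y)%g), (x^-1 * y)%g => //; exists x => //; exists y.
by exists 0 => _ [g _ <-]; case: (len_length l).
Qed.

Let dist_le l N X Y x y : lcosets N X -> lcosets N Y -> X x -> Y y ->
  quotient_dist l X Y <= l (x^-1 * y)%g.
Proof.
move=> NX NY Xx Yy; apply: inf_lbound; first exact: (values_has_inf l NX NY).2.
by exists (x^-1 * y)%g => //; exists x => //; exists y.
Qed.

Lemma len_discrete l : exists2 d, 0 < d & forall g, l g < d -> g = 1%g.
Proof.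
have [l0 _ _ l1] := len_length l.
have [s sE] : exists s : seq G, [set g | l g <= 1] = [set` s].
  by apply/finite_seqP/len_proper.
exists (\big[Num.min/1]_(g <- s | g != 1%g) l g).
  rewrite lt_bigmin// => g /eqP g1; rewrite lt_neqAle l0 andbT.
  by apply/eqP => /esym/l1.
move=> g lg; apply: contrapT => /eqP g1; move: lg; apply/negP; rewrite -leNgt.
have [lg|lg] := leP (l g) 1.
  have : [set` s] g by rewrite -sE.
  by move=> /= gs; apply: ge_bigmin_seq.
exact: (le_trans (bigmin_le_id _ _ _ _) (ltW lg)).
Qed.

Section MetricInstance.
Context (l : properLength R G) (N : finIndexNormal G).

HB.instance Definition _ := Choice.on (quotient_space l N).

Let d (X Y : quotient_space l N) : R := quotient_dist l (val X) (val Y).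

Let cosetP (X : quotient_space l N) : lcosets N (val X).
Proof. exact: set_mem (valP X). Qed.

Let dxx (X : quotient_space l N) : d X X = 0.
Proof.
have [x Xx] := lcosets_neq0 (cosetP X).
have [l0 _ _ l1] := len_length l.
apply/eqP; rewrite eq_le; apply/andP; split.
  rewrite -((l1 1%g).2 erefl) -(mulVg x).
  exact: (dist_le l (cosetP X) (cosetP X)).
apply: lb_le_inf; first by have [] := values_has_inf l (cosetP X) (cosetP X).
by move=> _ [g _ <-].
Qed.

Let d_eq0 (X Y : quotient_space l N) : d X Y = 0 -> X = Y.
Proof.
move=> dXY; have [e e0 le] := len_discrete l.
have [_ [_ [x Xx [y Yy <-]] <-]] :=
  inf_adherent e0 (values_has_inf l (cosetP X) (cosetP Y)).
rewrite -[inf _]/(d X Y) dXY add0r => /le xy.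
have yx : y = x by apply: (mulgI (x^-1)%g); rewrite xy mulVg.
apply: val_inj; apply: (lcosets_eq (cosetP X) (cosetP Y) Xx).
by rewrite -yx.
Qed.

Let d_sym (X Y : quotient_space l N) : d X Y = d Y X.
Proof.
have [_ _ lV _] := len_length l.
congr inf; apply/seteqP; split=> _ [_ [x Xx [y Yy <-]] <-];
  exists (y^-1 * x)%g; by [exists y => //; exists x | rewrite -lV invgM invgK].
Qed.

Let d_triangle (Y X Z : quotient_space l N) : d X Z <= d X Y + d Y Z.
Proof.
have [_ lD _ _] := len_length l; have gN := fin_subgroup N.
apply/ler_addgt0Pl => e e0; have e20 : 0 < e / 2 by rewrite divr_gt0.
have [_ [_ [x Xx [y Yy <-]] <-] xy] :=
  inf_adherent e20 (values_has_inf l (cosetP X) (cosetP Y)).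
have [_ [_ [y' Yy' [z Zz <-]] <-] yz] :=
  inf_adherent e20 (values_has_inf l (cosetP Y) (cosetP Z)).
have Ny : (N : set G) (y'^-1 * y)%g by apply/(lcosetsP _ (cosetP Y)).
have Zw : val Z (y * y'^-1 * z)%g.
  apply/(lcosetsP _ (cosetP Z) Zz).
  have -> : (z^-1 * (y * y'^-1 * z) = (y'^-1 * y) ^ (y'^-1 * z))%g.
    by rewrite /conjg !invgM !invgK !mulgA !mulgK.
  exact: fin_normal.
apply: (le_trans (dist_le l (cosetP X) (cosetP Z) Xx Zw)).
have -> : (x^-1 * (y * y'^-1 * z) = (x^-1 * y) * (y'^-1 * z))%g.
  by rewrite !mulgA.
apply: (le_trans (lD _ _)); apply: ltW; apply: (lt_le_trans (ltrD xy yz)).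
by rewrite addrACA -splitr addrC.
Qed.

HB.instance Definition _ :=
  isMetric.Build R (quotient_space l N) dxx d_eq0 d_sym d_triangle.

End MetricInstance.
End QuotientMetric.

(* Non-decreasing proper self-maps of [0, +oo[; values at negative reals are
   irrelevant. *)
Definition is_control (R : realType) (rho : R -> R) : Prop :=
  [/\ forall t, 0 <= t -> 0 <= rho t,
      forall s t, 0 <= s -> s <= t -> rho s <= rho t &
      rho t @[t --> +oo] --> +oo].

(* The metric spaces are given by their distance functions so that the
   definition applies both to metricTypes and to normed modules. *)
Definition coarse_embedding (R : realType) (X Y : Type)
    (dX : X -> X -> R) (dY : Y -> Y -> R) (F : X -> Y) : Prop :=
  exists rho_m rho_p : R -> R,
  [/\ is_control rho_m, is_control rho_p &
      forall x x', rho_m (dX x x') <= dY (F x) (F x') <= rho_p (dX x x')].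

(* A real Hilbert space: complete, with norm coming from an inner product. *)
Definition is_hilbert (R : realType) (H : completeNormedModType R) : Prop :=
  exists dot : {dot H for idfun}, forall u, `|u| ^+ 2 = dot u u.

Definition coarsely_embeds_into_hilbert (R : realType) (X : metricType R) :
    Prop :=
  exists2 H : completeNormedModType R, is_hilbert H &
  exists F : X -> H, coarse_embedding (@mdist R X) (fun u v => `|u - v|) F.

Definition mbounded (R : realType) (X : metricType R) (S : set X) : Prop :=
  exists M : R, forall x y, S x -> S y -> mdist x y <= M.

(* The distance to the empty set is +oo. *)
Definition dist_to_set (R : realType) (X : metricType R) (x : X) (S : set X) :
  \bar R := ereal_inf [set (mdist x y)%:E | y in S].

Definition is_coarse_disjoint_union (R : realType)
    (X_ : nat -> metricType R) (X : metricType R) : Prop :=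
  exists p : X -> nat,
  [/\ forall n, exists phi : X_ n -> X,
        range phi = p @^-1` [set n] /\
        forall x y, mdist (phi x) (phi y) = mdist x y,
      exists2 rho : R -> R, is_control rho &
        forall x y : X, `|2 ^+ p x - 2 ^+ p y| <= rho (mdist x y) &
      forall (r : R) (n m : nat), 0 < r -> n <> m ->
        mbounded [set x | p x = n /\
                          (dist_to_set x (p @^-1` [set m]) <= r%:E)%E]].

Definition is_box_space (R : realType) (G : groupType) (l : properLength R G)
    (N : nat -> finIndexNormal G) (X : metricType R) : Prop :=
  is_coarse_disjoint_union (fun n => quotient_space l (N n)) X.

(* Main.v *)
From HB Require Import structures.
Require Import Defs.
From mathcomp Require Import all_boot all_order all_algebra all_fingroup.
From mathcomp Require Import all_classical all_reals all_analysis.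
From mathcomp Require Import finmap.
From mathcomp Require Import zify ring lra.

(* The finite index subgroups come from mod 2 covers.  Choose a finite quotient
   K of G = A * B whose graph of cosets of the images of A and B (a quotient of
   the Bass-Serre tree, with edge set K) has large girth, and let N be the
   group of all g trivial in K such that the path from 1 to g in that graph
   crosses every edge an even number of times.  Then each set of edges at a
   common vertex yields a wall of G/N, on one side or the other of which g lies
   according to the parity of the number of crossings of that set.  Taking as
   sets of edges the translates of Folner sets of A and B gives a wall
   structure: the Folner property bounds the number of walls (suitably weighted)
   between g and gh in terms of h only, and conversely, when few walls separate
   1 from g, large girth forces the crossed edges to form a geodesic whose steps
   all lift to a fixed finite subset of A and B.  The square root of a weighted
   wall metric embeds isometrically into a Hilbert space. *)

Set Implicit Arguments.
Unset Strict Implicit.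
Unset Printing Implicit Defensive.

Import Order.TTheory GRing.Theory Num.Theory.
Import numFieldNormedType.Exports.

(** * Alternating paths in a graph of large girth *)

(** Crossing single edges only counts syllables, while one syllable from an infinite factor may be
    arbitrarily long: larger Folner sets are there to control this. Scale k of the factor c has one
    wall for each element of K, of weight 1/|F c k|, so a letter s pays at scale k at most the
    proportions of [F c k] that s and its inverse move out of [F c k]. As scale k + 1 is chosen with
    proportion at most 2^-k for all letters of length at most k, these costs are summable over the
    scales. Conversely, a step that is no quotient u^-1 v of elements of [F c k] is detected by |F c
    k| walls and pays at least 1 at scale k; a total cost of at most s thus forces every step to be
    such a quotient at one of the first floor(s) + 1 scales. Neither bound involves K, provided that
    girth and number of scales are large compared with s and that K is injective on the sets
    [F c k]. For given s this excludes only finitely many quotients, which are absorbed into the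
    constants. Amenability being given by a mean, Folner sets come from Hall's theorem: without them
    there would be a paradoxical decomposition. *)

Section AlternatingPaths.
Context (T : finType) (r : bool -> rel T).
Hypothesis r_equiv : forall c, equivalence_rel (r c).
Implicit Types (c : bool) (x y z u v : T) (p : seq T) (w : bool -> {set T}).

Let rxx c x : r c x x. Proof. by have [] := r_equiv c x x x. Qed.

Let rl c x y z : r c x y -> r c x z = r c y z.
Proof. by have [_] := r_equiv c x y z; apply. Qed.

Let rC c x y : r c x y = r c y x.
Proof. by apply/idP/idP => h; [rewrite -(rl x h)|rewrite -(rl y h)]. Qed.

(** Points of [T] are edges of a bipartite graph and the classes of [r c] its vertices of color [c];
    these are the edge paths without backtracking. *)
Fixpoint altpath c x p :=
  if p is y :: p' then [&& x != y, r c x y & altpath (~~ c) y p'] else true.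

Definition girth_gt L := forall c x p,
  0 < size p <= L -> altpath c x p -> last x p != x.

(** The mod 2 chain of a path: a step adds the edges where it enters and leaves its vertex to the
    chain of that vertex's color. *)
Fixpoint toggled c x p c' z :=
  if p is y :: p' then
    ((c' == c) && ((z == x) (+) (z == y))) (+) toggled (~~ c) y p' c' z
  else false.

Fixpoint all_steps (P : bool -> T -> T -> Prop) c x p :=
  if p is y :: p' then P c x y /\ all_steps P (~~ c) y p' else True.

Lemma altpath_cat c x p q :
  altpath c x (p ++ q) = altpath c x p && altpath (c (+) odd (size p)) (last x p) q.
Proof.
elim: p c x => [|y p IHp] c x /=; first by rewrite addbF.
by rewrite IHp -!andbA addNb addbN.
Qed.

Lemma toggled_mem c x p c' z : toggled c x p c' z -> z \in x :: p.
Proof.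
elim: p c x => //= y p IHp c x; rewrite !inE.
case: (toggled (~~ c) y p c' z) (IHp (~~ c) y) => [/(_ isT)|_].
  by rewrite !inE => /orP[]->; rewrite !orbT.
by rewrite addbF => /andP[_]; case: (z == x) (z == y) => -[].
Qed.

(** Otherwise a first step from the last edge to [x] would extend the path to a closed one with one
    more step, whence the strict bound on the length. *)
Lemma altpath_not_closing L c x p : girth_gt L -> altpath c x p ->
  0 < size p < L -> ~~ r (~~ c) x (last x p).
Proof.
move=> gL xp /andP[p0 pL]; apply/negP => rxl.
have pL' : 0 < size p <= L by rewrite p0 ltnW.
have := gL (~~ c) (last x p) (x :: p); rewrite /= negbK xp rC rxl eqxx andbT.
by rewrite (gL c x p pL' xp) pL => /(_ isT isT).
Qed.

(** Evenness gives every edge of [w] another edge of [w] at each of its two vertices, so an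
    alternating path inside [w] never gets stuck. After #|w| steps some edge has been repeated, and
    the part in between is a short closed path. *)
Lemma even_set_eq0 L (w : {set T}) : girth_gt L -> #|w| <= L ->
  (forall c x, ~~ odd #|w :&: [set z | r c x z]|) -> w = finset.set0.
Proof.
move=> gL wL even_w; apply/eqP; rewrite -finset.subset0; apply/fintype.subsetP => x xw.
have next c y : y \in w -> exists2 z, z \in w & (y != z) && r c y z.
  move=> yw; have : y \in w :&: [set z | r c y z] by rewrite !inE yw rxx.
  move=> yr; have := even_w c y; rewrite (cardsD1 y) yr /= negbK => odd_.
  have /card_gt0P[z] : 0 < #|(w :&: [set z | r c y z]) :\ y| by case: #|_| odd_.
  by rewrite !inE => /and3P[zy zw ryz]; exists z => //; rewrite eq_sym zy.
have path_ k c y : y \in w ->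
    exists p, [/\ size p = k, altpath c y p & {subset y :: p <= w}].
  elim: k c y => [|k IHk] c y yw.
    by exists [::]; split=> // z; rewrite inE => /eqP->.
  have [z zw /andP[yz rz]] := next c y yw.
  have [p [<- zp pw]] := IHk (~~ c) z zw.
  exists (z :: p); rewrite /= yz rz; split=> // t; rewrite inE.
  by case/predU1P => [->//|]; exact: pw.
have [p [sp xp pw]] := path_ #|w| true x xw.
have /(uniqPn x)[i [j [ij jp nth_ij]]] : ~~ uniq (x :: p).
  apply/negP => /card_uniqP /= cp.
  have := subset_leq_card (introT fintype.subsetP pw); rewrite cp sp.
  by rewrite ltnn.
have [i' [q1 [q2 [q1E q2E]]]] : exists k q1 q2, p = q1 ++ q2 ++ k /\
  [/\ size q1 = i, size q2 = j - i & True].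
  exists (drop j p), (take i p), (drop i (take j p)).
  rewrite catA -{1}(take_takel p (ltnW ij)) cat_take_drop cat_take_drop.
  move: jp => /=; rewrite ltnS => jp.
  by split=> //; split=> //; rewrite ?size_drop !size_takel ?(ltnW (leq_trans ij jp)).
case: q2E => s1 s2 _; move: xp; rewrite q1E !altpath_cat => /and3P[_ a2 _].
have: last (last x q1) q2 != last x q1.
  apply: gL a2; rewrite s2 subn_gt0 ij /= (leq_trans (leq_subr _ _))//.
  by move: jp; rewrite /= ltnS sp => /leq_trans; apply.
rewrite -last_cat => /eqP[]; rewrite (last_nth x) (last_nth x) size_cat s1 s2 subnKC 1?ltnW//.
move: nth_ij; rewrite q1E.
have cut a b k : k <= size a -> nth x (x :: a ++ b) k = nth x (x :: a) k.
  by case: k => //= k; rewrite nth_cat => ->.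
rewrite (cut q1 _ i) ?s1// catA (cut (q1 ++ q2) _ j).
  by move=> ->.
by rewrite size_cat s1 s2 subnKC// ltnW.
Qed.

(* The start u lies in exactly one of the two chains, say of color c, so by
   evenness that chain has another point u' in the class of u: the first step
   goes to u', and induction applies to the chains without u and u'.  A third
   point in that class would be visited later, which closes a short path. *)
Lemma path_extraction L w u v : girth_gt L ->
  #|w true| + #|w false| <= L ->
  (forall c x, ~~ odd #|w c :&: [set z | r c x z]|) ->
  (forall z, (z \in w true) (+) (z \in w false) = (z == u) (+) (z == v)) ->
  exists c p, [/\ altpath c u p, last u p = v & size p <= #|w true| + #|w false|] /\
    [/\ p = [::] \/ u \in w c,
      forall c' z, (z \in w c') = toggled c u p c' z &
      all_steps (fun c' x y => w c' :&: [set z | r c' x z] = [set x; y]) c u p].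
Proof.
move=> gL; have [n] := ubnP (#|w true| + #|w false|).
elim: n w u => // n IHn w u; rewrite ltnS => wn wL even_w sum_w.
(* If [u] = [v], the two chains coincide; the common chain is even for both colors, hence empty. *)
have [uv|uv] := eqVneq u v.
  have w_tf : w true = w false.
    by apply/setP => z; apply/eqP; rewrite -negb_add sum_w uv addbb.
  have w0 c : w c = finset.set0.
    apply: (even_set_eq0 gL) => [|c' x].
      by apply: leq_trans wL; case: c; rewrite ?leq_addr ?leq_addl.
    by have := even_w c' x; case: c c' => -[]; rewrite // ?w_tf // -w_tf.
  exists true, [::]; split=> //; split=> //; first by left.
  by move=> c z; rewrite w0 inE.
have [c uc uNc] : exists2 c, u \in w c & u \notin w (~~ c).
  move: (sum_w u); rewrite eqxx (negbTE uv) /=.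
  by case: (boolP (u \in w true)); [exists true|exists false].
have [u' [u'u u'c ruu']] : exists u', [/\ u' != u, u' \in w c & r c u u'].
  have uin : u \in w c :&: [set z | r c u z] by rewrite !inE uc rxx.
  have := even_w c u; rewrite (cardsD1 u) uin /= negbK => odd_.
  have /card_gt0P[z] : 0 < #|(w c :&: [set z | r c u z]) :\ u| by case: #|_| odd_.
  by rewrite !inE => /and3P[zu zw ruz]; exists z.
pose w' c' := if c' == c then w c' :\ u :\ u' else w c'.
have w'c : w' c = w c :\ u :\ u' by rewrite /w' eqxx.
have w'N : w' (~~ c) = w (~~ c) by have cN : (~~ c == c) = false; [case: (c)|rewrite /w' cN].
have card_w : #|w c| = #|w' c|.+2.
  by rewrite w'c (cardsD1 u) uc (cardsD1 u') !inE u'u u'c.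
have cards : #|w true| + #|w false| = (#|w' true| + #|w' false|).+2.
  by case: (c) card_w w'N => /= -> ->; rewrite ?addSn ?addnS.
have even_w' c' x : ~~ odd #|w' c' :&: [set z | r c' x z]|.
  have [->|/negbTE c'c] := eqVneq c' c; last by rewrite /w' c'c.
  have := even_w c x; rewrite w'c.
  have [rxu|/negbTE rxu] := boolP (r c x u).
    rewrite (cardsD1 u) !inE uc rxu (cardsD1 u') !inE u'u u'c (rl _ rxu) ruu'.
    rewrite /= negbK; congr (~~ odd _); apply: eq_card => z; rewrite !inE.
    by rewrite -!andbA.
  congr (~~ odd _); apply: eq_card => z; rewrite !inE.
  have [->|] := eqVneq z u; first by rewrite rxu !andbF.
  have [->|//] := eqVneq z u'.
  by rewrite rC -(rl _ ruu') rC rxu !andbF.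
have sum_w' z : (z \in w' true) (+) (z \in w' false) = (z == u') (+) (z == v).
  have : (z \in w' true) (+) (z \in w' false) =
      ((z \in w true) (+) (z \in w false)) (+) ((z == u) (+) (z == u')).
    have -> : (z == u) (+) (z == u') = (z \in w c) (+) (z \in w' c).
      rewrite w'c !inE; have [->|] := eqVneq z u; first by rewrite uc eq_sym (negbTE u'u).
      by have [->|] := eqVneq z u'; rewrite ?u'c ?addbb.
    by case: (c) w'N => /= ->; case: (z \in _) (z \in _) => -[]; case: (z \in _).
  by move=> ->; rewrite sum_w; case: (z == u) (z == v) (z == u') => -[] [].
have [||//|//|c1 [p [[pc1 p_last sp] [pu' w'E stepsp]]]] := IHn w' u'.
- by rewrite -ltnS -ltnS -cards ltnW.
- by apply: leq_trans wL; rewrite cards ltnW.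
(* The path found by induction leaves [u'] by the other color, because [u'] has been removed from
   the chain of color [c]. *)
have c1E : p = [::] \/ c1 = ~~ c.
  case: pu' => [|u'1]; [by left|right].
  have [c1c|] := eqVneq c1 c; last by case: (c1) (c) => -[].
  by move: u'1; rewrite c1c w'c !inE eqxx.
have {}pc1 : altpath (~~ c) u' p by case: c1E pc1 => ->.
have {}w'E c' z : (z \in w' c') = toggled (~~ c) u' p c' z.
  by rewrite w'E; case: c1E => ->.
have {}stepsp : all_steps (fun c' x y => w' c' :&: [set z | r c' x z] = [set x; y])
    (~~ c) u' p by case: c1E stepsp => ->.
have wc_u : w c :&: [set z | r c u z] = [set u; u'].
  apply/setP => z; rewrite !inE; have [->|zu] := eqVneq z u; first by rewrite uc rxx.
  have [->|zu'] /= := eqVneq z u'; first by rewrite u'c ruu'.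
  apply/negP => /andP[zc ruz].
  have : z \in w' c by rewrite w'c !inE zu zu'.
  rewrite w'E => /toggled_mem; rewrite inE (negbTE zu') /= => zp.
  case/splitPr: zp pc1 sp => p1 p2; rewrite -cat_rcons altpath_cat => /andP[pz _] sp.
  have sz : 0 < size (rcons p1 z) < L.
    rewrite size_rcons /=; apply: leq_trans wL; rewrite cards !ltnS.
    apply: leq_trans sp; rewrite size_cat size_rcons addSn; apply: leqW.
    exact: leq_addr.
  by have := altpath_not_closing gL pz sz; rewrite last_rcons negbK -(rl _ ruu') ruz.
exists c, (u' :: p); split; split=> /=.
- by rewrite eq_sym u'u ruu' pc1.
- by [].
- by rewrite cards ltnS ltnW.
- by right.
- move=> c' z; rewrite -w'E; have [->|/negbTE c'c] /= := eqVneq c' c; last first.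
    by rewrite /w' c'c.
  rewrite w'c !inE; have [->|] := eqVneq z u; first by rewrite uc eq_sym (negbTE u'u).
  by have [->|] := eqVneq z u'; rewrite ?u'c.
(* The chains [w] and [w'] differ only inside the class of [u], which no later step of color [c]
   meets. *)
split=> //; elim: p (~~ c) (u') stepsp {pc1 sp pu' w'E p_last c1E} => //= y p IHp c' x [wx].
move=> /IHp; split=> //; rewrite -wx.
have [c'c|/negbTE c'c] := eqVneq c' c; last by rewrite /w' c'c.
subst c'; apply/setP => z; rewrite w'c !inE.
have [rux|/negbTE rux] := boolP (r c u x).
  have : x \in w' c :&: [set z | r c x z] by rewrite wx !inE eqxx.
  rewrite w'c !inE => /andP[/and3P[xu' xu xc] _].
  have : x \in w c :&: [set z | r c u z] by rewrite !inE xc.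
  by rewrite wc_u !inE (negbTE xu) (negbTE xu').
have [->|] := eqVneq z u; first by rewrite rC rux !andbF.
have [->|//] := eqVneq z u'.
by rewrite rC -(rl _ ruu') rux !andbF.
Qed.

End AlternatingPaths.

(** * Hall's theorem and Folner sets *)

Section Hall.
Local Open Scope fset_scope.
Context (I J : choiceType).
Implicit Types (Z : {fset I}).

Definition nbrs (M : I -> {fset J}) Z : {fset J} := \bigcup_(x <- Z) M x.

Lemma nbrsP M Z y : reflect (exists2 x, x \in Z & y \in M x) (y \in nbrs M Z).
Proof.
apply: (iffP (bigfcupP _ _ _ _)) => -[x].
  by rewrite andbT => xZ yx; exists x.
by move=> xZ yx; exists x; rewrite // xZ.
Qed.

Lemma nbrs_sub M M' Z : {in Z, forall x, M x `<=` M' x} -> nbrs M Z `<=` nbrs M' Z.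
Proof.
move=> MM'; apply/fsubsetP => y /nbrsP[x xZ yx]; apply/nbrsP; exists x => //.
exact: (fsubsetP (MM' x xZ)).
Qed.

Definition hall_cond M := forall Z, #|` Z| <= #|` nbrs M Z|.

(** Zorn's lemma for reverse inclusion. The lower bound of a chain is its pointwise minimum,
    attained because the sets are finite; on a given finite [Z] a single member of the chain lies
    below it, so Hall's condition survives. *)
Lemma minimal_hall_cond M : hall_cond M ->
  exists M', [/\ hall_cond M', forall x, M' x `<=` M x &
    forall M'', hall_cond M'' -> (forall x, M'' x `<=` M' x) -> M'' = M'].
Proof.
move=> hM; pose S := {M' | hall_cond M' /\ forall x, M' x `<=` M x}.
pose le (M1 M2 : S) := `[< forall x, projT1 M2 x `<=` projT1 M1 x >].
have S_eq (M1 M2 : S) : projT1 M1 = projT1 M2 -> M1 = M2.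
  by case: M1 M2 => M1 h1 [M2 h2] /= e; subst M2; congr exist; exact: Prop_irrelevance.
have [||||M' M'min] := @Zorn S le.
- by move=> M1; apply/asboolP => x; exact: fsubset_refl.
- move=> M2 M1 M3 /asboolP h12 /asboolP h23; apply/asboolP => x.
  exact: fsubset_trans (h23 x) (h12 x).
- move=> M1 M2 /asboolP h12 /asboolP h21; apply: S_eq; apply/funext => x; apply/eqP.
  by rewrite eqEfsubset h21 h12.
- move=> C totC.
  have [[M0 CM0]|C0] := pselect (exists M0, C M0); last first.
    by exists (exist _ M (conj hM (fun x => fsubset_refl _))) => M1 CM1; case: C0; exists M1.
  have minP x : exists M1, C M1 /\ forall M2, C M2 -> projT1 M1 x `<=` projT1 M2 x.
    pose P n := `[< exists M1, C M1 /\ #|` projT1 M1 x| = n >].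
    have exP : exists n, P n by exists #|` projT1 M0 x|; apply/asboolP; exists M0.
    case: (ex_minnP exP) => n /asboolP[M1 [CM1 M1n]] n_min.
    exists M1; split=> // M2 CM2; case: (totC _ _ CM1 CM2) => /asboolP h12; last exact: h12.
    have -> // : projT1 M1 x = projT1 M2 x.
    apply/esym/eqP; rewrite eqEfcard h12 M1n n_min//; apply/asboolP.
    by exists M2.
  pose Mi x := projT1 (cid (minP x)).
  have MiC x : C (Mi x) by have [] := projT2 (cid (minP x)).
  have Mi_min x M2 : C M2 -> projT1 (Mi x) x `<=` projT1 M2 x.
    by have [_] := projT2 (cid (minP x)); apply.
  pose Minf x := projT1 (Mi x) x.
  have finC (s : seq I) : exists M1, C M1 /\ {in s, forall x, projT1 M1 x `<=` Minf x}.
    elim: s => [|x s [M1 [CM1 M1s]]]; first by exists M0.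
    case: (totC _ _ CM1 (MiC x)) => /asboolP h.
      exists (Mi x); split=> // y; rewrite inE => /predU1P[->|/M1s].
        exact: fsubset_refl.
      by apply: fsubset_trans; exact: h.
    by exists M1; split=> // y; rewrite inE => /predU1P[->|/M1s//]; exact: h.
  have hinf : hall_cond Minf /\ forall x, Minf x `<=` M x.
    split=> [Z|x]; last by have [_] := projT2 (Mi x); apply.
    have [M1 [CM1 M1Z]] := finC Z; have [hM1 _] := projT2 M1.
    by apply: leq_trans (hM1 Z) _; apply: fsubset_leq_card; exact: nbrs_sub.
  exists (exist _ Minf hinf) => M1 CM1; apply/asboolP => x /=; exact: Mi_min.
have [hM' M'M] := projT2 M'.
exists (projT1 M'); split=> // M'' hM'' M''M'.
have M''M x : M'' x `<=` M x by exact: fsubset_trans (M''M' x) (M'M x).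
exact: (congr1 (fun K : S => projT1 K)
  (M'min (exist _ M'' (conj hM'' M''M)) (introT (asboolP _) M''M'))).
Qed.

(* Rado's proof: in a minimal family every set is a singleton, because if two
   different points could not be removed from M x, then submodularity of the
   number of neighbours would contradict Hall's condition. *)
Theorem hall M : hall_cond M ->
  exists f : I -> J, injective f /\ forall x, f x \in M x.
Proof.
move=> /minimal_hall_cond[M' [hM' M'M M'min]].
have [f fM'] : exists f : I -> J, forall x, f x \in M' x.
  have M'0 x : exists y, y \in M' x.
    have := hM' [fset x]; rewrite cardfs1 cardfs_gt0 => /fset0Pn[y /nbrsP[z]].
    by rewrite inE => /eqP->; exists y.
  by exists (fun x => projT1 (cid (M'0 x))) => x; exact: projT2 (cid (M'0 x)).
have removal x y : y \in M' x -> exists Z,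
    x \notin Z /\ #|` nbrs M' Z `|` (M' x `\ y)| <= #|` Z|.
  move=> yx; pose M1 z := if z == x then M' x `\ y else M' z.
  have /existsNP[Z /negP] : ~ hall_cond M1.
    move=> hM1; have M1M' : M1 = M'.
      apply: M'min => // z; rewrite /M1; case: eqP => [->|_]; last exact: fsubset_refl.
      exact: fsubsetDl.
    have := congr1 (fun h => h x) M1M'; rewrite /M1 eqxx => /fsetP/(_ y).
    by rewrite !inE eqxx yx.
  rewrite -ltnNge => ltZ.
  have M1E z : z != x -> M1 z = M' z by move=> /negbTE zx; rewrite /M1 zx.
  have xZ : x \in Z.
    apply: contraLR ltZ => xZ; rewrite -leqNgt (leq_trans (hM' Z))//.
    apply: fsubset_leq_card; apply: nbrs_sub => z zZ.
    by rewrite M1E ?fsubset_refl//; apply: contraNneq xZ => <-.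
  exists (Z `\ x); split; first by rewrite !inE eqxx.
  rewrite -ltnS (leq_trans _ (_ : #|` Z| <= _))//; last by rewrite (cardfsD1 x) xZ.
  apply: leq_ltn_trans ltZ; apply: fsubset_leq_card; apply/fsubsetP => z.
  rewrite inE => /orP[/nbrsP[t]|zM].
    by rewrite !inE => /andP[tx tZ] zt; apply/nbrsP; exists t; rewrite ?M1E.
  by apply/nbrsP; exists x; rewrite // /M1 eqxx.
have M'1 x y : y \in M' x -> y = f x.
  move=> yx; apply: contrapT => /eqP yf.
  have [Z1 [xZ1 le1]] := removal x y yx.
  have [Z2 [xZ2 le2]] := removal x (f x) (fM' x).
  set U1 := _ `|` _ in le1; set U2 := _ `|` _ in le2.
  (* As [y] differs from [f x], the union of [U1] and [U2] contains all of [M' x]. Adding [leU] and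
     [leI] gives |Z1| + |Z2| + 1 <= |U1| + |U2|, against [le1] and [le2]. *)
  have leU : #|` x |` (Z1 `|` Z2)| <= #|` U1 `|` U2|.
    apply: leq_trans (hM' _) _; apply: fsubset_leq_card; apply/fsubsetP => z.
    move=> /nbrsP[t]; rewrite !inE => /or3P[/eqP->|tZ|tZ] zt.
    - have [->|zy] := eqVneq z y; first by rewrite yf yx !orbT.
      by rewrite zt !orbT.
    - by apply/orP; left; apply/orP; left; apply/nbrsP; exists t.
    - by apply/orP; right; apply/orP; left; apply/nbrsP; exists t.
  have leI : #|` Z1 `&` Z2| <= #|` U1 `&` U2|.
    apply: leq_trans (hM' _) _; apply: fsubset_leq_card; apply/fsubsetP => z.
    move=> /nbrsP[t]; rewrite !inE => /andP[t1 t2] zt.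
    by apply/andP; split; apply/orP; left; apply/nbrsP; exists t.
  move: leU; rewrite cardfsU1 !inE (negbTE xZ1) (negbTE xZ2) /=.
  by have := cardfsUI U1 U2; have := cardfsUI Z1 Z2; lia.
exists f; split=> [x x' fxx'|x]; last exact: (fsubsetP (M'M x)).
apply: contrapT => /eqP xx'.
have := hM' [fset x; x']; rewrite cardfs2 xx' /=.
have : #|` nbrs M' [fset x; x']| <= #|` [fset f x]|.
  apply: fsubset_leq_card; apply/fsubsetP => y /nbrsP[z].
  by rewrite !inE => /orP[]/eqP-> /M'1->; rewrite ?fxx'.
by rewrite cardfs1; lia.
Qed.

End Hall.

(** * From invariant means to Folner sets *)

Section Folner.
Local Open Scope fset_scope.
Context (A : groupType).
Implicit Types E F U : {fset A}.

Definition prodf E F : {fset A} := [fset (x * y)%g | x in E, y in F].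

Lemma prodfP E F z :
  reflect (exists x y, [/\ x \in E, y \in F & z = (x * y)%g]) (z \in prodf E F).
Proof.
apply: (iffP (imfset2P _ _ _ _ _)) => [[x /= xE [y /= yF ->]]|[x [y [xE yF ->]]]].
  by exists x, y.
by exists x => //; exists y.
Qed.

Lemma prodfA E F U : prodf E (prodf F U) = prodf (prodf E F) U.
Proof.
apply/fsetP => z; apply/prodfP/prodfP.
  move=> [x [_ [xE /prodfP[y [t [yF tU ->]]] ->]]]; exists (x * y)%g, t.
  by rewrite mulgA; split=> //; apply/prodfP; exists x, y.
move=> [_ [t [/prodfP[x [y [xE yF ->]]] tU ->]]]; exists x, (y * t)%g.
by rewrite mulgA; split=> //; apply/prodfP; exists y, t.
Qed.

Lemma prod1f F : prodf [fset 1%g] F = F.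
Proof.
apply/fsetP => z; apply/prodfP/idP => [[x [y []]]|zF].
  by rewrite inE => /eqP-> yF ->; rewrite mul1g.
by exists 1%g, z; rewrite inE mul1g.
Qed.

  Local Open Scope classical_set_scope.

(** On each copy of [A] the map [f] is piecewise a left translation by one of the finitely many
    elements of [U], so it preserves the mean; two disjoint subsets of [A] would both have measure
    1. *)
Lemma paradox_not_amenable (R : realType) U (f : A * bool -> A) :
  injective f -> (forall x b, (f (x, b) * x^-1)%g \in U) -> ~ amenable R A.
Proof.
move=> f_inj fU [mu [mu0 muT muD muL]].
have mu_set0 : mu set0 = 0%R.
  have := muD set0 set0; rewrite setI0 setU0 => /(_ erefl).
  by move=> /eqP; rewrite addrC -subr_eq subrr => /eqP.
have image_mu b (s : seq A) :
    uniq s -> let D := [set x | (f (x, b) * x^-1)%g \in s] in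
    mu [set f (x, b) | x in D] = mu D.
  elim: s => [_|u s IHs /= /andP[us uniq_s]].
    rewrite /= (_ : [set x | _] = set0) ?image_set0//.
    by apply/seteqP; split=> x.
  pose D1 := [set x | f (x, b) = (u * x)%g].
  pose D2 := [set x | (f (x, b) * x^-1)%g \in s].
  have -> : [set x | (f (x, b) * x^-1)%g \in u :: s] = D1 `|` D2.
    apply/seteqP; split=> x; rewrite /D1 /D2 /= inE.
      by case/predU1P => [<-|]; [left; rewrite mulgVK|right].
    by case=> [->|->]; rewrite ?mulgK ?eqxx ?orbT.
  have D12 : D1 `&` D2 = set0.
    apply/seteqP; split=> // x []; rewrite /D1 /D2 /= => ->.
    by rewrite mulgK (negbTE us).
  rewrite image_setU !muD//; last first.
    apply/seteqP; split=> // y [[x D1x <-] [x' D2x' /f_inj[]]] xx'.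
    have : (D1 `&` D2) x by split=> //; rewrite -xx'.
    by rewrite D12.
  rewrite (IHs uniq_s); congr (_ + _)%R.
  rewrite -(muL u D1); congr mu; apply/seteqP; split=> y [x D1x <-].
    by exists x => //; rewrite D1x.
  by exists x => //; rewrite D1x.
have fT b : mu (range (fun x => f (x, b))) = 1%R.
  rewrite -muT -[in RHS](_ : [set x | (f (x, b) * x^-1)%g \in U] = setT).
    rewrite -(image_mu b U (fset_uniq U)); congr mu.
    by apply/seteqP; split=> y [x _ <-]; exists x => //=; exact: fU.
  by apply/seteqP; split=> // x _ /=; exact: fU.
have /muD : range (fun x => f (x, true)) `&` range (fun x => f (x, false)) = set0.
  by apply/seteqP; split=> // y [[x _ <-] [x' _ /f_inj]].
rewrite !fT; set S := (_ `|` _) => S2.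
have := muD S (~` S) (setICr S); rewrite setUCr muT S2.
by have := mu0 (~` S); lra.
Qed.

(** Bernoulli's inequality for (1 + 1/m)^m: expanding [m] times by the factor 1 + 1/m at least
    doubles a finite set. *)
Lemma bernoulli2 m : 0 < m -> 2 * m ^ m <= m.+1 ^ m.
Proof.
case: m => // m _.
have bern k : m.+1 ^ k + k * m.+1 ^ k.-1 <= m.+2 ^ k.
  elim: k => [|k IHk]; first by rewrite !expn0.
  case: k IHk => [|k] IHk; first by rewrite !expn1 expn0; lia.
  rewrite [m.+2 ^ _]expnS; apply: leq_trans (leq_mul (leqnn _) IHk).
  rewrite /= [m.+1 ^ k.+2]expnS [m.+1 ^ k.+1]expnS; nia.
by apply: leq_trans (bern m.+1); rewrite /= -expnS mul2n addnn.
Qed.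

(* Otherwise multiplication by E1 = 1 |` E expands every F by 1 + 1/m, so that
   multiplication by E1 ^ m doubles it, and Hall's theorem turns this doubling
   into a paradoxical decomposition. *)
Lemma left_folner (R : realType) : amenable R A -> forall E m,
  exists F, F != fset0 /\
    {in E, forall a, m * #|` prodf [fset a] F `\` F| <= #|` F|}%fset.
Proof.
move=> amA E m; apply: contrapT => noF; apply: noF.
wlog m0 : m / 0 < m => [th|].
  case: m => [|m]; last exact: th.
  by exists [fset 1%g]; split=> [|a _]; rewrite ?mul0n// -cardfs_gt0 cardfs1.
apply: contrapT => noF.
pose E1 := (1%g |` E)%fset.
have expand F : m.+1 * #|` F| <= m * #|` prodf E1 F|.
  rewrite leqNgt; apply/negP => ltF; apply: noF; exists F; split.
    by apply: contraTneq ltF => ->; rewrite cardfs0 muln0.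
  move=> a aE; set D := (_ `\` _)%fset.
  have DF : [disjoint D & F]%fset.
    by apply/fdisjointP => x; rewrite inE => /andP[].
  have : #|` D `|` F|%fset <= #|` prodf E1 F|.
    apply: fsubset_leq_card; apply/fsubsetP => x; rewrite !inE => /orP[].
      move=> /andP[_ /prodfP[y [z [/fset1P-> zF ->]]]]; apply/prodfP.
      by exists a, z; rewrite !inE aE orbT.
    by move=> xF; apply/prodfP; exists 1%g, x; rewrite !inE eqxx mul1g.
  rewrite cardfsU (eqP (_ : D `&` F == fset0)%fset) ?cardfs0 ?subn0; last by rewrite fsetI_eq0.
  nia.
pose U := iter m (prodf E1) [fset 1%g]%fset.
have expandU k F : m.+1 ^ k * #|` F| <= m ^ k * #|` prodf (iter k (prodf E1) [fset 1%g]%fset) F|.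
  elim: k => [|k IHk]; first by rewrite prod1f.
  rewrite iterS -prodfA !expnS -mulnA.
  apply: leq_trans (leq_mul (leqnn m.+1) IHk) _.
  rewrite mulnCA [m * m ^ k]mulnC -mulnA leq_mul2l; apply/orP; right.
  exact: expand.
have doubling F : 2 * #|` F| <= #|` prodf U F|.
  have mm : 0 < m ^ m by rewrite expn_gt0 m0.
  rewrite -(leq_pmul2l mm); apply: leq_trans (expandU m F).
  by rewrite mulnA leq_mul2r mulnC bernoulli2 ?orbT.
pose M (xb : A * bool) := prodf U [fset xb.1]%fset.
have /hall[f [f_inj fM]] : hall_cond M.
  move=> Z; pose F := [fset xb.1 | xb in Z]%fset.
  apply: leq_trans (_ : 2 * #|` F| <= _).
    pose Fb (b : bool) := [fset (x, b) | x in F]%fset.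
    have cFb b : #|` Fb b| = #|` F| by rewrite card_imfset// => x y [].
    apply: (@leq_trans #|` Fb true `|` Fb false|%fset); last first.
      by rewrite cardfsU !cFb mul2n addnn leq_subr.
    apply: fsubset_leq_card; apply/fsubsetP => -[x b] xbZ; rewrite inE.
    have xF : x \in F by apply/imfsetP; exists (x, b).
    by case: b {xbZ}; apply/orP; [left|right]; apply/imfsetP; exists x.
  apply: leq_trans (doubling F) _; apply: fsubset_leq_card; apply/fsubsetP => z.
  move=> /prodfP[u [_ [uU /imfsetP[xb /= xbZ ->] ->]]].
  apply/nbrsP; exists xb => //; apply/prodfP; exists u, xb.1.
  by rewrite inE eqxx.
apply: (@paradox_not_amenable R U f f_inj _ amA) => x b.
have /prodfP[u [y [uU /fset1P-> ->]]] := fM (x, b).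
by rewrite mulgK.
Qed.

(** Inversion exchanges the two sides. The right-hand version is the useful one, since a letter
    moves edges by right multiplication while walls are translated on the left. *)
Lemma right_folner (R : realType) : amenable R A -> forall (E : seq A) m,
  exists F, F != fset0 /\ {in E, forall a,
    m * #|` [fset x in F | (x * a)%g \notin F]| <= #|` F|}%fset.
Proof.
move=> amA E m.
have [F [F0 FE]] := left_folner amA [fset a^-1%g | a in E]%fset m.
have invE (S : {fset A}) : #|` [fset x^-1%g | x in S]%fset| = #|` S|.
  by rewrite card_imfset//; exact: invg_inj.
exists [fset x^-1%g | x in F]%fset; split.
  by rewrite -cardfs_gt0 invE cardfs_gt0.
move=> a aE; rewrite invE.
have aE' : (a^-1)%g \in [fset a^-1%g | a in E]%fset by apply/imfsetP; exists a.
apply: leq_trans (FE _ aE'); rewrite leq_mul2l; apply/orP; right.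
set S := (X in #|` X| <= _).
have <- : #|` [fset (x * a)^-1%g | x in S]%fset| = #|` S|.
  by rewrite card_imfset// => x y /invg_inj/mulIg.
apply: fsubset_leq_card; apply/fsubsetP => _ /imfsetP[x /= + ->].
rewrite !inE /= => /andP[/imfsetP[y /= yF ->] yaF]; apply/andP; split.
  by apply: contra yaF => yaF; apply/imfsetP; exists ((y^-1 * a)^-1)%g; rewrite ?invgK.
by apply/prodfP; exists (a^-1)%g, y; rewrite inE eqxx invgM invgK.
Qed.
End Folner.

(** * Finite quotients of free products *)

Section Morphisms.
Local Open Scope group_scope.

Definition mult_of (G H : groupType) (f : G -> H) (fM : {morph f : x y / x * y}) :
    {multiplicative G -> H} :=
  HB.pack_for {multiplicative G -> H} f (isMultiplicative.Build G H f fM).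

Lemma mult_ofE (G H : groupType) (f : G -> H) (fM : {morph f : x y / x * y}) x :
  mult_of fM x = f x.
Proof. by []. Qed.

Lemma mult1 (G H : groupType) (f : {multiplicative G -> H}) : f 1 = 1.
Proof. by apply: (mulgI (f 1)); rewrite -gmulfM !mulg1. Qed.

Lemma multV (G H : groupType) (f : {multiplicative G -> H}) x : f x^-1 = (f x)^-1.
Proof. by apply: (mulgI (f x)); rewrite -gmulfM !mulgV mult1. Qed.

(** Products of permutations are composed from left to right, so right actions correspond to
    morphisms. *)
Lemma right_action_mult (S : groupType) (T : finType) (act : T -> S -> T) :
  (forall x, act x 1 = x) ->
  (forall x s t, act x (s * t) = act (act x s) t) ->
  exists f : {multiplicative S -> {perm T}}, forall s x, f s x = act x s.
Proof.
move=> act1 actM.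
have act_inj s : injective (act^~ s).
  by move=> x y /(congr1 (act^~ s^-1)); rewrite -!actM mulgV !act1.
have fM : {morph (fun s => perm (@act_inj s)) : s t / s * t}.
  by move=> s t; apply/permP => x; rewrite permM !permE.
by exists (mult_of fM) => s x; rewrite mult_ofE permE.
Qed.

End Morphisms.

Section ResiduallyFinite.
Local Open Scope group_scope.
Context (S : groupType).
  Local Open Scope classical_set_scope.

(** The group acts on the finite set of cosets by X -> g^-1 X, and [a] moves the coset [N]. *)
Lemma fin_index_separation (N : finIndexNormal S) (a : S) : ~ (N : set S) a ->
  exists (H : finGroupType) (f : {multiplicative S -> H}), f a != 1.
Proof.
move=> Na; have /finite_seqP[s sE] := fin_index N.
have sP X : (X \in s) = (X \in Defs.lcosets N) :> bool.
  by apply/idP/idP => [Xs|/set_mem]; [apply/mem_set; rewrite sE|rewrite sE].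
have moveP (X : seq_sub s) (g : S) : Defs.lcoset (val X) g^-1 \in s.
  rewrite sP; apply/mem_set.
  have /set_mem[h _ <-] : val X \in Defs.lcosets N by rewrite -sP; exact: valP.
  exists (g^-1 * h) => //; apply/seteqP; split=> [_ [n Nn <-]|_ [_ [n Nn <-] <-]].
    by exists (h * n); [exists n|rewrite mulgA].
  by exists n => //; rewrite mulgA.
pose act (X : seq_sub s) g : seq_sub s := SeqSub (moveP X g).
have [||f fE] := @right_action_mult S (seq_sub s) act.
- move=> X; apply: val_inj; rewrite /= invg1; apply/seteqP; split=> [_ [x Xx <-]|x Xx].
    by rewrite mul1g.
  by exists x; rewrite ?mul1g.
- move=> X g h; apply: val_inj; apply/seteqP; split=> [_ [x Xx <-]|_ [_ [x Xx <-] <-]] /=.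
    by exists (g^-1 * x); [exists x|rewrite invgM mulgA].
  by exists x => //; rewrite invgM mulgA.
exists {perm (seq_sub s)}, f; apply/eqP => fa1.
have Ns : (N : set S) \in s.
  rewrite sP; apply/mem_set; exists 1 => //; apply/seteqP; split=> [_ [x Nx <-]|x Nx].
    by rewrite mul1g.
  by exists x; rewrite ?mul1g.
have := fE a (SeqSub Ns); rewrite fa1 perm1 => /(congr1 val) /= NE.
have [N1 _] := fin_subgroup N.
have : (N : set S) 1 by [].
rewrite [X in X 1]NE => -[x Nx /(congr1 (fun y => a * y))].
by rewrite mulKVg mulg1 => xa; rewrite xa in Nx.
Qed.

Lemma residually_finite_seq : residually_finite S -> forall s : seq S,
  exists (H : finGroupType) (f : {multiplicative S -> H}),
    {in s, forall a, a != 1 -> f a != 1}.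
Proof.
move=> rfS; elim=> [|a s [H [f fs]]].
  have oneM : {morph (fun _ : S => 1 : {perm bool}) : x y / x * y}.
    by move=> x y; rewrite mulg1.
  by exists {perm bool}, (mult_of oneM).
have [a1|/rfS[N /fin_index_separation[H' [f' f'a]]]] := pselect (a = 1).
  by exists H, f => b; rewrite inE => /predU1P[->|/fs//]; rewrite a1 eqxx.
have gM : {morph (fun x => (f x, f' x) : H * H') : x y / x * y}.
  by move=> x y; rewrite !gmulfM.
exists (H * H')%type, (mult_of gM) => b; rewrite inE => /predU1P[-> _|bs b1].
  by apply: contra f'a => /eqP[_ ->].
by apply: contra (fs b bs b1) => /eqP[-> _].
Qed.

End ResiduallyFinite.

(* The two factors are indexed by bool so that both can be treated at once. *)
Definition is_coproduct (S : bool -> groupType) (G : groupType)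
    (i : forall c, {multiplicative S c -> G}) : Prop :=
  forall (K : groupType) (f : forall c, {multiplicative S c -> K}),
  exists h : {multiplicative G -> K}, (forall c s, h (i c s) = f c s) /\
    forall h' : {multiplicative G -> K},
      (forall c s, h' (i c s) = f c s) -> h' =1 h.

Section Words.
Local Open Scope group_scope.
Context (S : bool -> groupType) (G : groupType).
Context (i : forall c, {multiplicative S c -> G}).

Definition letter : Type := {c : bool & S c}.
HB.instance Definition _ := Choice.on letter.
Implicit Types (t : letter) (w : seq letter) (g : G).

Definition mk_letter c (s : S c) : letter := existT _ c s.

Definition letter_val t : G := i (tag t) (tagged t).

Definition wval w : G := foldr (fun t g => letter_val t * g) 1 w.

Lemma wval_cat w1 w2 : wval (w1 ++ w2) = wval w1 * wval w2.
Proof. by elim: w1 => [|t w1 IHw] /=; rewrite ?mul1g// IHw mulgA. Qed.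

Definition winv w : seq letter :=
  rev [seq mk_letter (tagged t)^-1 | t <- w].

Lemma wval_inv w : wval (winv w) = (wval w)^-1.
Proof.
elim: w => [|t w IHw]; first by rewrite invg1.
rewrite /winv map_cons rev_cons -cats1 wval_cat [wval (rev _)]IHw /= mulg1.
by rewrite invgM /letter_val /= multV.
Qed.

Definition word_pred : pred G := fun g => `[< exists w, wval w = g >].

Fact word_pred_closed : group_closed word_pred.
Proof.
split; first by apply/asboolP; exists [::].
move=> x y /asboolP[w1 <-] /asboolP[w2 <-]; apply/asboolP.
by exists (w1 ++ winv w2); rewrite wval_cat wval_inv.
Qed.

Record word_group := WordGroup { word_elt :> G; word_eltP : word_pred word_elt }.
HB.instance Definition _ := [isSub for word_elt].
HB.instance Definition _ := [Choice of word_group by <:].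
HB.instance Definition _ :=
  SubChoice_isSubGroup.Build G word_pred word_group word_pred_closed.

Hypothesis coprodG : is_coproduct i.

(** The universal property gives a morphism from [G] to the subgroup of values of words. Followed by
    the inclusion it fixes both factors, so by uniqueness it is the identity. *)
Lemma word_surj g : exists w, wval w = g.
Proof.
have inP c (s : S c) : word_pred (i c s).
  by apply/asboolP; exists [:: mk_letter s]; rewrite /= mulg1.
pose f0 c (s : S c) : word_group := WordGroup (inP c s).
have fM c : {morph f0 c : x y / x * y}.
  by move=> x y; apply: val_inj; rewrite /= gmulfM.
have [h [hE _]] := coprodG (fun c => mult_of (fM c)).
have vM : {morph (fun g => word_elt (h g)) : x y / x * y}.
  by move=> x y; rewrite gmulfM.
have idM : {morph (fun g : G => g) : x y / x * y} by [].
have [k [_ kE]] := coprodG i.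
have -> : g = word_elt (h g).
  transitivity (k g); first by rewrite -(kE (mult_of idM)).
  by rewrite -(kE (mult_of vM))// => c s; rewrite mult_ofE hE.
by apply/asboolP; case: (h g).
Qed.

Lemma word_ind (P : G -> Prop) : P 1 ->
  (forall g c (s : S c), P g -> P (g * i c s)) -> forall g, P g.
Proof.
move=> P1 PM g; have [w <-] := word_surj g.
elim/last_ind: w => [//|w [c s] IHw].
by rewrite -cats1 wval_cat /= mulg1; exact: PM.
Qed.

(** The identity on [S c] and the trivial morphism on the other factor induce a retraction of
    [i c]. *)
Lemma coproduct_inj c : injective (i c).
Proof.
have oneM (c' : bool) : {morph (fun _ : S c' => 1 : S c) : x y / x * y}.
  by move=> x y; rewrite mulg1.
have [f fE] : exists f : forall c', {multiplicative S c' -> S c}, forall x, f c x = x.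
  pose f c' : {multiplicative S c' -> S c} :=
    match c' =P c with
    | ReflectT e => ecast x {multiplicative S c' -> S x} e (mult_of
       (fun x y : S c' => erefl (x * y)))
    | ReflectF _ => mult_of (@oneM c')
    end.
  exists f; rewrite /f; case: eqP => // e.
  by rewrite (eq_axiomK e).
have [h [hE _]] := coprodG f.
by move=> x y xy; have := hE c x; rewrite xy hE !fE.
Qed.

Definition alternating_word w := sorted (fun t t' => tag t != tag t') w.

Definition reduced w := all (fun t => tagged t != 1) w && alternating_word w.

Lemma reduced_word g : exists2 w, reduced w & wval w = g.
Proof.
have [w <-] := word_surj g; elim: w => [|[c s] w [w' w'r /= <-]]; first by exists [::].
have [->|s1] := eqVneq s 1; first by exists w' => //; rewrite /= /letter_val /= mult1 mul1g.
case: w' w'r => [|[c' s'] w'] w'r.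
  by exists [:: mk_letter s] => //; rewrite /reduced /= s1.
have [cc'|cc'] := eqVneq c c'; last first.
  exists [:: mk_letter s, mk_letter s' & w'] => //.
  by move: w'r; rewrite /reduced /= s1 cc'.
case: c' / cc' s' w'r => s' w'r.
have w'r0 : reduced w'.
  by move: w'r; rewrite /reduced /alternating_word /= => /andP[/andP[_ ->] /path_sorted].
have val_ : wval (mk_letter s :: mk_letter s' :: w') = i c (s * s') * wval w'.
  by rewrite /= mulgA /letter_val /= gmulfM.
have [ss'|ss'] := eqVneq (s * s') 1.
  by exists w' => //; rewrite [RHS]val_ ss' mult1 mul1g.
exists (mk_letter (s * s') :: w'); last by rewrite [RHS]val_.
move: w'r; rewrite /reduced /alternating_word /= ss' => /andP[/andP[_ ->] pw'].
by case: (w') pw'.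
Qed.

End Words.

Section GirthQuotient.
Local Open Scope group_scope.
Context (S : bool -> groupType) (G : groupType).
Context (i : forall c, {multiplicative S c -> G}).
Hypothesis coprodG : is_coproduct i.
Context (H : finGroupType) (a : forall c, {multiplicative S c -> H}) (L : nat).

(* For every sequence f of nontrivial elements of H and every color c0, take n
   copies of the regular H-set.  Letters of color c0 act on the copies of even
   index; the others act on those of odd index, after conjugation by swap, which
   glues the point f j of copy j to the point 1 of copy j + 1.  An alternating
   word with letters f 0, f 1, ... thus moves the point 1 of copy 0 through
   consecutive copies. *)
Let n := L.+2.

Implicit Types (f : {ffun 'I_n -> H}) (p : 'I_n * H) (w : seq (letter S)).

Let good f := [forall j, f j != 1].

(** The copies are arranged cyclically only to make this an involution of the whole set; a word of
    length at most [L] is too short to go around. *)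
Let swap f p :=
  if p.2 == f p.1 then (ordS p.1, 1)
  else if p.2 == 1 then (ord_pred p.1, f (ord_pred p.1)) else p.

Let swapK f : good f -> involutive (swap f).
Proof.
move=> /forallP f1 [j x]; rewrite /swap /=.
have [->|xf] := eqVneq x (f j); first by rewrite /= eq_sym (negbTE (f1 _)) eqxx ordSK.
have [->|x1] := eqVneq x 1; first by rewrite /= eqxx ord_predK.
by rewrite /= (negbTE xf) (negbTE x1).
Qed.

Let mulb (b : bool) p (h : H) := if odd p.1 == b then (p.1, p.2 * h) else p.

Let mulb1 b p : mulb b p 1 = p.
Proof. by case: p => j x; rewrite /mulb mulg1 /=; case: ifP. Qed.

Let mulbM b p h k : mulb b p (h * k) = mulb b (mulb b p h) k.
Proof. by rewrite /mulb; case: ifP => /= ->; rewrite ?mulgA. Qed.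

Let X := ((bool * {ffun 'I_n -> H}) * ('I_n * H))%type.

(** One finite set has to serve all short words at once, hence the sum over all [c0] and [f]. For a
    bad [f], where [swap f] may fail to be an involution, the action is trivial. *)
Let move c (x : X) (h : H) : X :=
  let: (c0, f, p) := x in
  if ~~ good f then x else
  if c == c0 then (c0, f, mulb false p h)
  else (c0, f, swap f (mulb true (swap f p) h)).

Let move1 c x : move c x 1 = x.
Proof.
case: x => [[c0 f] p]; rewrite /move !mulb1; case: ifPn => // /negbNE gf.
by rewrite swapK//; case: ifP.
Qed.

Let moveM c x h k : move c x (h * k) = move c (move c x h) k.
Proof.
case: x => [[c0 f] p]; rewrite /move; case: ifPn => [bf|/negbNE gf].
  by rewrite bf.
by case: ifPn => cc0; rewrite gf /= ?cc0 ?(negbTE cc0) !mulbM ?swapK.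
Qed.

(** For odd [k], the point 1 of copy [k] is represented by the point of copy [k] - 1 to which it is
    glued. *)
Let pos f k : 'I_n * H :=
  if odd k then swap f (inord k, 1) else (inord k, 1).

Let move_pos c0 f k c h : good f -> k.+1 < n -> f (inord k) = h ->
  c = c0 (+) odd k -> move c (c0, f, pos f k) h = (c0, f, pos f k.+1).
Proof.
move=> gf kn fk ->; rewrite /move gf /= /pos /=.
have k'n := ltnW kn; have /forallP f1 := gf.
have ordSk : ordS (inord k : 'I_n) = inord k.+1.
  by apply: val_inj; rewrite /= !inordK// modn_small.
have ordPk : ord_pred (inord k.+1 : 'I_n) = inord k by rewrite -ordSk ordSK.
case: (boolP (odd k)) => [ok|ok]; rewrite ?addbT ?addbF.
  rewrite [_ == _](_ : _ = false); last by case: (c0).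
  by rewrite (swapK gf) /mulb /= inordK// ok eqxx mul1g -fk /swap /= eqxx ordSk.
rewrite eqxx /mulb /= inordK// (negbTE ok) eqxx mul1g /= /swap /=.
by rewrite eq_sym (negbTE (f1 _)) eqxx ordPk fk.
Qed.

(** The last clause serves to lift paths: a step that is nontrivial in [K] comes from a letter that
    is nontrivial in [H], to which the first clause applies. *)
Lemma girth_quotient : exists (K : finGroupType) (pi : {multiplicative G -> K}),
  (forall w, 0 < size w <= L ->
     all (fun t => a (tag t) (tagged t) != 1) w -> alternating_word w ->
     pi (wval i w) != 1) /\
  forall c s, a c s = 1 -> pi (i c s) = 1.
Proof.
have rhoP c : exists f : {multiplicative S c -> {perm X}},
    forall s x, f s x = move c x (a c s).
  apply: (@right_action_mult _ _ (fun x s => move c x (a c s))) => [x|x s t].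
    by rewrite mult1 move1.
  by rewrite gmulfM moveM.
pose rho c := projT1 (cid (rhoP c)).
have rhoE c s x : rho c s x = move c x (a c s) := projT2 (cid (rhoP c)) s x.
have [pi [piE _]] := coprodG rho.
exists {perm X}, pi; split=> [w|c s as1]; last first.
  by rewrite piE; apply/permP => x; rewrite rhoE as1 move1 perm1.
pose av (t : letter S) := a (tag t) (tagged t).
have trace c0 f : good f -> forall w k, k + size w < n -> alternating_word w ->
    (if w is t :: _ then tag t = c0 (+) odd k else True) ->
    (forall m, m < size w -> f (inord (k + m)) = nth 1 (map av w) m) ->
    pi (wval i w) (c0, f, pos f k) = (c0, f, pos f (k + size w)).
  move=> gf; elim=> [|t {}w IHw] k /= kn alt_w tk fw.
    by rewrite mult1 perm1 addn0.
  rewrite gmulfM permM piE rhoE (move_pos gf _ _ tk); last 2 first.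
  - by apply: leq_ltn_trans kn; rewrite -addn1 leq_add2l.
  - by have := fw 0 isT; rewrite addn0.
  rewrite IHw ?addSnnS//; first exact: path_sorted alt_w.
    case: w alt_w {IHw kn fw} => //= t' w /andP[tt' _].
    by move: tt'; rewrite tk addbN; case: (tag t'); case: (c0 (+) odd k).
  by move=> m mw; rewrite addSnnS fw.
move=> /andP[w0 wL] w1 alt_w; apply/eqP => piw.
case: w w0 wL w1 alt_w piw => // t w _ wL w1 alt_w piw.
(* Padding with the first letter keeps all values nontrivial, as [good] demands. *)
pose f : {ffun 'I_n -> H} := [ffun j : 'I_n => nth (av t) (map av (t :: w)) j].
have gf : good f.
  apply/forallP => j; rewrite ffunE.
  have [jw|jw] := ltnP j (size (t :: w)).
    by rewrite (nth_map t)//; apply: (allP w1); exact: mem_nth.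
  rewrite nth_default ?size_map//; by case/andP: w1.
have kn : 0 + size (t :: w) < n by rewrite add0n /n ltnS leqW.
have fE m : m < size (t :: w) -> f (inord (0 + m)) = nth 1 (map av (t :: w)) m.
  move=> mw; rewrite add0n ffunE inordK ?(ltn_trans mw)//.
  by apply: set_nth_default; rewrite size_map.
have := @trace (tag t) f gf (t :: w) 0 kn alt_w _ fE.
rewrite addbF piw perm1 add0n => /(_ erefl).
(* The start is the point 1 of copy 0. After an odd number of letters the second coordinate is a
   value of [f], hence not 1; after an even number the copy is not 0. *)
rewrite /pos; rewrite add0n in kn.
case: ifP => _.
  rewrite /swap /=; have /forallP f1 := gf; rewrite eq_sym (negbTE (f1 _)) eqxx.
  by case=> _ /eqP; rewrite eq_sym (negbTE (f1 _)).
by case=> /(congr1 val); rewrite /= !inordK.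
Qed.

End GirthQuotient.

(** * The mod 2 cover *)

Section Parity.
Local Open Scope group_scope.
Context (T : finType).
Implicit Types P Q : pred T.

Lemma odd_card_addb P Q :
  odd #|[pred z | P z (+) Q z]| = odd #|P| (+) odd #|Q|.
Proof.
have oddE (P' : pred T) : odd #|P'| = \big[addb/false]_z P' z.
  rewrite -sum1_card big_mkcond (big_morph odd oddD (erefl _)).
  by apply: eq_bigr => z _; rewrite unfold_in; case: (P' z).
by rewrite !oddE -big_split.
Qed.

Lemma odd_card_pair a b P :
  odd #|[pred z | ((z == a) (+) (z == b)) && P z]| = P a (+) P b.
Proof.
have one c : odd #|[pred z | (z == c) && P z]| = P c.
  case Pc: (P c); last by rewrite eq_card0// => z; rewrite inE; case: eqP => // ->.
  rewrite (@eq_card _ _ (pred1 c)) ?card1// => z; rewrite !inE.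
  by case: eqP => // ->.
rewrite -(one a) -(one b) -odd_card_addb; congr (odd _); apply: eq_card => z.
by rewrite !inE andb_addl.
Qed.

End Parity.

Section CoverQuotient.
Local Open Scope group_scope.
Context (S : bool -> groupType) (G : groupType).
Context (i : forall c, {multiplicative S c -> G}).
Hypothesis coprodG : is_coproduct i.
Context (K : finGroupType) (pi : {multiplicative G -> K}).

Let bar c (s : S c) : K := pi (i c s).

Let barM c (s t : S c) : bar (s * t) = bar s * bar t.
Proof. by rewrite /bar !gmulfM. Qed.

Let T := (K * {ffun bool * K -> bool})%type.

(* Edges are the elements of K, the vertices of color c being the cosets of the
   image of S c.  A state consists of the current edge and of two mod 2 chains;
   a letter of color c moves along a vertex of color c and adds to the chain of
   color c the edge where it enters that vertex and the edge where it leaves. *)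
Let act c (x : T) (s : S c) : T :=
  (x.1 * bar s, [ffun dz => x.2 dz (+)
    ((dz.1 == c) && ((dz.2 == x.1) (+) (dz.2 == x.1 * bar s)))]).

Let act1 c (x : T) : @act c x 1 = x.
Proof.
rewrite /act /bar !mult1 mulg1; case: x => x w; congr (_, _); apply/ffunP => dz.
by rewrite ffunE addbb andbF addbF.
Qed.

Let actM c (x : T) (s t : S c) : act x (s * t) = act (act x s) t.
Proof.
rewrite /act barM mulgA; congr (_, _); apply/ffunP => dz; rewrite !ffunE /=.
by rewrite -addbA -andb_addr addbA addbK.
Qed.

Let lact_ex c : exists f : {multiplicative S c -> {perm T}},
  forall s x, f s x = act x s.
Proof. exact: right_action_mult (@act1 c) (@actM c). Qed.

Let cover_ex : exists rho : {multiplicative G -> {perm T}},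
  forall c (s : S c) x, rho (i c s) x = act x s.
Proof.
have [rho [rhoE _]] := coprodG (fun c => projT1 (cid (lact_ex c))).
by exists rho => c s x; rewrite rhoE (projT2 (cid (lact_ex c))).
Qed.

Definition cover : {multiplicative G -> {perm T}} := projT1 (cid cover_ex).

Let coverE c (s : S c) x : cover (i c s) x = act x s.
Proof. exact: (projT2 (cid cover_ex)). Qed.

Let state g : T := cover g (1, [ffun=> false]).

(** This depends on [g] and not on a word for it, because [cover] is a morphism out of the
    coproduct. *)
Definition crossed g c z : bool := (state g).2 (c, z).

Let state1 : state 1 = (1, [ffun=> false]).
Proof. by rewrite /state mult1 perm1. Qed.

Let state_letter g c (s : S c) : state (g * i c s) = act (state g) s.
Proof. by rewrite /state gmulfM permM coverE. Qed.

Let state_pi g : (state g).1 = pi g.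
Proof.
elim/(word_ind coprodG): g => [|g c s IHg]; first by rewrite state1 mult1.
by rewrite state_letter /= IHg gmulfM.
Qed.

Lemma crossed1 c z : crossed 1 c z = false.
Proof. by rewrite /crossed state1 ffunE. Qed.

Lemma crossed_letter g c (s : S c) d z : crossed (g * i c s) d z =
  crossed g d z (+) ((d == c) && ((z == pi g) (+) (z == pi g * pi (i c s)))).
Proof. by rewrite /crossed state_letter ffunE /= state_pi. Qed.

Let translate (x y : T) : T :=
  (x.1 * y.1, [ffun dz => x.2 dz (+) y.2 (dz.1, x.1^-1 * dz.2)]).

(** Letters act from the right and so commute with translating the start on the left; hence
    [state g] determines the whole permutation [cover g]. *)
Let coverT g x : cover g x = translate x (state g).
Proof.
have tr0 : translate x (1, [ffun=> false]) = x.
  rewrite /translate mulg1; case: x => x w; congr (_, _); apply/ffunP => dz.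
  by rewrite !ffunE addbF.
rewrite -{1}tr0 /state; move: (1, _) => y.
elim/(word_ind coprodG): g => [|g c s IHg]; first by rewrite mult1 !perm1.
rewrite gmulfM !permM !coverE IHg /translate /act /=; congr (_, _).
  by rewrite mulgA.
apply/ffunP => dz; rewrite !ffunE /= addbA; congr (_ (+) (_ && _)).
have e b : (x.1^-1 * dz.2 == b) = (dz.2 == x.1 * b).
  exact: (can2_eq (mulKVg x.1) (mulKg x.1)).
by rewrite !e !mulgA.
Qed.

(** A path for [g * h] is one for [g] followed by the translate by [pi g] of one for [h]. *)
Lemma crossedM g h c z :
  crossed (g * h) c z = crossed g c z (+) crossed h c ((pi g)^-1 * z).
Proof.
by rewrite /crossed {1}/state gmulfM permM coverT ffunE /= -/(state g) state_pi.
Qed.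

(** Each intermediate edge is toggled twice, at the end of one step and at the start of the next, so
    only the two ends remain. *)
Lemma crossed_sum g z :
  crossed g true z (+) crossed g false z = (z == 1) (+) (z == pi g).
Proof.
elim/(word_ind coprodG): g => [|g c s IHg]; first by rewrite !crossed1 mult1 !addbb.
rewrite !crossed_letter addbACA IHg gmulfM.
by case: c s => s /=; case: (z == 1); case: (z == pi g); case: (z == pi g * _).
Qed.

Definition same_coset c (x y : K) : bool := `[< exists s : S c, y = x * pi (i c s) >].

Lemma same_coset_equiv c : equivalence_rel (same_coset c).
Proof.
move=> x y z; split; first by apply/asboolP; exists 1; rewrite !mult1 mulg1.
move=> /asboolP[s ->]; apply/asboolP/asboolP => -[t ->].
  by exists (s^-1 * t); rewrite !gmulfM !multV -mulgA mulKVg.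
by exists (s * t); rewrite !gmulfM mulgA.
Qed.

Definition crossed_set g c : {set K} := [set z | crossed g c z].

(** A letter toggles two edges at the same vertex. With [crossed_sum], this provides the hypotheses
    of [path_extraction]. *)
Lemma crossed_even g c x :
  ~~ odd #|crossed_set g c :&: [set z | same_coset c x z]|.
Proof.
rewrite (@eq_card _ _ [pred z | crossed g c z && same_coset c x z]); last first.
  by move=> z; rewrite !inE.
elim/(word_ind coprodG): g => [|g d s IHg].
  by rewrite eq_card0// => z; rewrite inE crossed1.
pose P z := (c == d) && ((z == pi g) (+) (z == pi g * pi (i d s))) && same_coset c x z.
rewrite (@eq_card _ _
    [pred z | (crossed g c z && same_coset c x z) (+) P z]); last first.
  by move=> z; rewrite !inE crossed_letter andb_addl.
rewrite (odd_card_addb (fun z => crossed g c z && same_coset c x z) P).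
rewrite (negbTE IHg) /= /P.
have [->|_] := eqVneq c d; last by rewrite eq_card0.
rewrite (odd_card_pair _ _ (same_coset d x)).
suff -> : same_coset d x (pi g * pi (i d s)) = same_coset d x (pi g) by rewrite addbb.
have sg : same_coset d (pi g) (pi g * pi (i d s)) by apply/asboolP; exists s.
have sym y y' : same_coset d y y' = same_coset d y' y.
  by apply/idP/idP => h; [rewrite -((same_coset_equiv d y y' y).2 h)
                         |rewrite -((same_coset_equiv d y' y y').2 h)];
     rewrite (same_coset_equiv d y y' _).1.
by rewrite ![same_coset d x _]sym ((same_coset_equiv d _ _ x).2 sg).
Qed.

Section CoverKernel.
  Local Open Scope classical_set_scope.

Definition cover_ker_set : set G := [set g | cover g = 1].

Let cover_ker_subgroup : is_subgroup cover_ker_set.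
Proof.
split; first exact: mult1.
by move=> x y; rewrite /cover_ker_set/= gmulfM multV => -> ->; rewrite invg1 mulg1.
Qed.

Let cover_ker_normal g x : cover_ker_set x -> cover_ker_set (x ^ g).
Proof.
rewrite /cover_ker_set/= /conjg !gmulfM multV => ->.
by rewrite mul1g mulVg.
Qed.

Let cover_ker_index : finite_set (Defs.lcosets cover_ker_set).
Proof.
apply: (@sub_finite_set _ _ [set [set h | cover h = p] | p in [set: {perm T}]]).
  move=> _ [g _ <-]; exists (cover g) => //; apply/seteqP; split=> h.
    move=> /= hg; exists (g^-1 * h); last by rewrite mulKVg.
    by rewrite /cover_ker_set/= gmulfM multV hg mulVg.
  by move=> [k Nk <-] /=; rewrite gmulfM Nk mulg1.
by apply: finite_image; exact: finite_finset.
Qed.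

Definition cover_ker : finIndexNormal G :=
  FinIndexNormal cover_ker_subgroup cover_ker_normal cover_ker_index.

Lemma cover_kerP g h : (cover_ker : set G) (g^-1 * h) <->
  pi g = pi h /\ forall c z, crossed g c z = crossed h c z.
Proof.
have eqc : (cover_ker : set G) (g^-1 * h) <-> cover g = cover h.
  rewrite /= /cover_ker_set /= gmulfM multV.
  by split=> [/(congr1 (fun x => cover g * x))|->]; rewrite ?mulVg// mulKVg mulg1.
rewrite eqc; split=> [gh|[pgh cgh]].
  by rewrite -!state_pi /crossed /state gh.
have sgh : state g = state h.
  rewrite [state g]surjective_pairing [state h]surjective_pairing !state_pi pgh.
  by congr (_, _); apply/ffunP => -[c z]; exact: cgh.
by apply/permP => x; rewrite !coverT sgh.
Qed.

Lemma cover_ker_pi g : (cover_ker : set G) g -> pi g = 1.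
Proof.
have := cover_kerP 1 g; rewrite invg1 mul1g => -> [].
by rewrite mult1.
Qed.

End CoverKernel.
End CoverQuotient.

(** * Walls cut out by finite subsets of the factors *)

Section Cuts.
Local Open Scope group_scope.
Context (R : realType) (S : bool -> groupType) (G : groupType).
Context (i : forall c, {multiplicative S c -> G}).
Hypothesis coprodG : is_coproduct i.
Context (K : finGroupType) (pi : {multiplicative G -> K}).
Context (F : forall c, nat -> {fset S c}).

Local Notation crossed := (crossed coprodG pi).
Local Notation N := (cover_ker coprodG pi).

Definition shape c k : {set K} := [set z in [seq pi (i c s) | s <- F c k]].

(* Parity of the intersection of the chain of g with the translate of the
   k-th shape by q, i.e. the side of the corresponding wall on which g lies. *)
Definition side c k q g : bool :=
  odd #|[pred z | crossed g c z && (q^-1 * z \in shape c k)]|.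

(** Since 1 lies on the side [false] of every wall, this counts the walls between 1 and [g], indexed
    by [q] and thus with multiplicity. *)
Definition separation c k g : nat := #|[pred q | side c k q g]|.

Lemma sideM c k q g h :
  side c k q (g * h) = side c k q g (+) side c k ((pi g)^-1 * q) h.
Proof.
pose P z := crossed g c z && (q^-1 * z \in shape c k).
pose Q z := crossed h c ((pi g)^-1 * z) && (q^-1 * z \in shape c k).
have -> : side c k q (g * h) = odd #|[pred z | P z (+) Q z]|.
  by rewrite /side; congr (odd _); apply: eq_card => z; rewrite [LHS]inE [RHS]inE /P /Q crossedM andb_addl.
rewrite odd_card_addb; congr (_ (+) _); congr (odd _).
rewrite -(fintype.card_image (mulgI (pi g)) [pred z | crossed h c z &&
  ((((pi g)^-1 * q)^-1 * z)%g \in shape c k)]).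
apply: eq_card => z; apply/idP/fintype.imageP.
  rewrite unfold_in /Q => Qz; exists ((pi g)^-1 * z); last by rewrite mulKVg.
  by rewrite inE invgM invgK -mulgA mulKVg.
by move=> [t + ->]; rewrite [in X in X -> _]inE unfold_in /Q mulKg invgM invgK -mulgA.
Qed.

Lemma side_ker c k q g h : (N : set G) h -> side c k q (g * h) = side c k q g.
Proof.
move=> Nh; have [|_ gh] := (cover_kerP coprodG pi g (g * h)).1; first by rewrite mulKg.
by rewrite /side; congr (odd _); apply: eq_card => z; rewrite !inE gh.
Qed.

Lemma separationM c k g h :
  separation c k (g * h) <= separation c k g + separation c k h.
Proof.
have -> : separation c k h = #|[pred q | side c k ((pi g)^-1 * q) h]|.
  rewrite /separation -(fintype.card_image (mulgI (pi g)) [pred q | side c k q h]).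
  apply: eq_card => q; apply/fintype.imageP/idP => [[t + ->]|].
    by rewrite !inE mulKg.
  by rewrite !inE => sq; exists ((pi g)^-1 * q); rewrite ?inE ?mulKVg.
rewrite -cardUI (leq_trans _ (leq_addr _ _))//; apply: subset_leq_card.
apply/fintype.subsetP => q; rewrite !inE sideM.
by case: (side c k q g).
Qed.

Definition defect c k s : nat := #|` [fset x in F c k | (x * s)%g \notin F c k]%fset|.

(** The chain of one letter is {1, pi s}, so the wall [q] separates when exactly one of q^-1 and
    q^-1 pi(s) lies in the shape. Either case lifts to a point of [F c k] moved out by s or by s^-1;
    several lifts only help. *)
Lemma separation_letter c k (s : S c) :
  separation c k (i c s) <= defect k s + defect k s^-1.
Proof.
pose A := [set q : K | (q^-1 \in shape c k) && (q^-1 * pi (i c s) \notin shape c k)].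
pose B := [set q : K | (q^-1 \notin shape c k) && (q^-1 * pi (i c s) \in shape c k)].
have sideE q : side c k q (i c s) =
    (q^-1 \in shape c k) (+) (q^-1 * pi (i c s) \in shape c k).
  have := odd_card_pair 1 (pi (i c s)) (fun z => q^-1 * z \in shape c k).
  rewrite mulg1 => <-; rewrite /side; congr (odd _); apply: eq_card => z.
  rewrite [LHS]inE [RHS]inE -[X in crossed X]mul1g crossed_letter.
  by rewrite crossed1 eqxx mult1 mul1g.
have AB : separation c k (i c s) <= #|A| + #|B|.
  rewrite -cardsUI (leq_trans _ (leq_addr _ _))//; apply: subset_leq_card.
  apply/fintype.subsetP => q; rewrite inE sideE finset.in_setU [q \in A]finset.in_set [q \in B]finset.in_set.
  by case: (q^-1 \in _); case: (_ \in shape c k).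
apply: leq_trans AB _; apply: leq_add; rewrite /defect.
  set D := [fset x in F c k | _]%fset.
  pose r := [seq (pi (i c x))^-1 | x <- D].
  apply: (@leq_trans #|[set z in r]|); last first.
    by rewrite cardsE (leq_trans (card_size _))// size_map.
  apply: subset_leq_card; apply/fintype.subsetP => q; rewrite !inE => /andP[].
  move=> /mapP[x xF qx] /mapP qs; apply/mapP; exists x; last by rewrite -qx invgK.
  rewrite !inE /= xF; apply/negP => xsF; apply: qs; exists (x * s) => //.
  by rewrite qx !gmulfM.
set D := [fset x in F c k | _]%fset.
pose r := [seq pi (i c s) * (pi (i c x))^-1 | x <- D].
apply: (@leq_trans #|[set z in r]|); last first.
  by rewrite cardsE (leq_trans (card_size _))// size_map.
apply: subset_leq_card; apply/fintype.subsetP => q; rewrite !inE => /andP[].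
move=> /mapP qs /mapP[x xF qx]; apply/mapP; exists x; last first.
  by rewrite -qx invgM invgK mulKVg.
rewrite !inE /= xF; apply/negP => xsF; apply: qs; exists (x * s^-1) => //.
by rewrite !gmulfM !multV -qx mulgK.
Qed.

Lemma separation_letterN c d k (s : S d) : c != d -> separation c k (i d s) = 0.
Proof.
move=> cd; apply: eq_card0 => q; rewrite !inE /side eq_card0// => z.
by rewrite !inE -[i d s]mul1g crossed_letter crossed1 (negbTE cd).
Qed.

Definition total_separation m g : R :=
  \sum_(c : bool) \sum_(k < m) (separation c k g)%:R / (#|` F c k|)%:R.

Definition wall_map m g (j : (bool * 'I_m) * K) : R :=
  (side j.1.1 j.1.2 j.2 g)%:R / Num.sqrt (#|` F j.1.1 j.1.2|)%:R.

Lemma wall_map_ker m g h j : (N : set G) h -> @wall_map m (g * h) j = wall_map g j.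
Proof. by move=> Nh; rewrite /wall_map side_ker. Qed.

Lemma wall_map_dist m g h :
  (\sum_j (@wall_map m g j - wall_map h j) ^+ 2 = total_separation m (g^-1 * h))%R.
Proof.
rewrite /wall_map -(pair_bigA _ (fun (p : bool * 'I_m) q => ((side p.1 p.2 q g)%:R /
  Num.sqrt (#|` F p.1 p.2|)%:R - (side p.1 p.2 q h)%:R /
  Num.sqrt (#|` F p.1 p.2|)%:R) ^+ 2)%R) /=.
rewrite -(pair_bigA _ (fun c (k : 'I_m) => \sum_q ((side c k q g)%:R /
  Num.sqrt (#|` F c k|)%:R - (side c k q h)%:R /
  Num.sqrt (#|` F c k|)%:R) ^+ 2)%R) /=.
apply: eq_bigr => c _; apply: eq_bigr => k _.
under eq_bigr => q _.
  rewrite -mulrBl expr_div_n sqr_sqrtr ?ler0n//.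
  rewrite (_ : (_ - _) ^+ 2 = (side c k ((pi g)^-1 * q)%g (g^-1 * h)%g)%:R)%R; last first.
    rewrite -{1}[h](mulKVg g) sideM.
    by case: (side c k q g); case: (side _ _ _ _) => /=; rewrite ?mulr1n ?mulr0n; lra.
  over.
rewrite -mulr_suml; congr (_ / _)%R; rewrite -natr_sum; congr _%:R%R.
rewrite /separation -sum1_card [RHS]big_mkcond /=.
rewrite (reindex_inj (mulgI (pi g))) /=; apply: eq_bigr => q _.
by rewrite mulKg inE; case: (side _ _ _ _).
Qed.

(** The bound depends on the word alone, neither on [K] nor, when [C] is chosen uniformly, on the
    number [m] of scales. *)
Lemma total_separation_word m (C : letter S -> R) (w : seq (letter S)) :
  (forall t, \sum_(k < m) (defect k (tagged t))%:R / (#|` F (tag t) k|)%:R <= C t)%R ->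
  (total_separation m (wval i w) <=
     \sum_(t <- w) (C t + C (mk_letter (tagged t)^-1)))%R.
Proof.
move=> defC; elim: w => [|t w IHw].
  rewrite big_nil /total_separation big1// => c _; rewrite big1// => k _.
  rewrite /separation eq_card0 ?mul0r// => q; rewrite inE /side eq_card0// => z.
  by rewrite inE /= crossed1.
rewrite big_cons; have sepD g h :
    (total_separation m (g * h)%g <= total_separation m g + total_separation m h)%R.
  rewrite /total_separation -big_split/=; apply: ler_sum => c _.
  rewrite -big_split/=; apply: ler_sum => k _; rewrite -mulrDl.
  by rewrite ler_wpM2r ?invr_ge0 ?ler0n// -natrD ler_nat separationM.
apply: (le_trans (sepD _ _)); apply: lerD => //.
rewrite /total_separation (bigD1 (tag t))//= [X in (_ + X)%R]big1 ?addr0; last first.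
  move=> c ct; rewrite big1// => k _.
  by rewrite separation_letterN// mul0r.
apply: (@le_trans _ _ (\sum_(k < m) ((defect k (tagged t))%:R / (#|` F (tag t) k|)%:R +
   (defect k (tagged t)^-1%g)%:R / (#|` F (tag t) k|)%:R))%R).
  apply: ler_sum => k _; rewrite -mulrDl ler_wpM2r ?invr_ge0 ?ler0n//.
  by rewrite -natrD ler_nat separation_letter.
by rewrite big_split lerD//; exact: (defC (mk_letter (tagged t)^-1%g)).
Qed.

Definition near_letter n (t : letter S) : Prop :=
  exists2 k, k < n & exists x y,
    [/\ x \in F (tag t) k, y \in F (tag t) k & tagged t = x^-1 * y].

(** For each [u] in [F c k], the translate of the shape by x pi(u)^-1 contains [x] but not [y], so
    it meets the chain of [g] in [x] alone and its wall separates. Injectivity makes these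
    translating elements distinct. *)
Lemma separation_step c k g x y :
  {in F c k &, injective (fun s => pi (i c s))} ->
  crossed_set coprodG pi g c :&: [set z | same_coset i pi c x z] = [set x; y] ->
  (forall u v, u \in F c k -> v \in F c k -> y != x * pi (i c (u^-1 * v))) ->
  #|` F c k| <= separation c k g.
Proof.
move=> injF gxy nearN.
have shapeP z : reflect (exists2 s, s \in F c k & z = pi (i c s)) (z \in shape c k).
  by rewrite inE; apply: mapP.
have -> : #|` F c k| = #|[set x * z^-1 | z in shape c k]|.
  rewrite card_imset; last by move=> z z' /mulgI/invg_inj.
  rewrite cardsE -(size_map (fun s => pi (i c s))).
  by apply/esym/card_uniqP; rewrite map_inj_in_uniq ?fset_uniq.
apply: subset_leq_card; apply/fintype.subsetP => _ /imsetP[_ /shapeP[u uF ->] ->].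
rewrite inE /side (@eq_card _ _ (pred1 x)) ?card1// => z; rewrite [LHS]inE [RHS]inE.
rewrite invgM invgK -mulgA; apply/andP/eqP => [[gz /shapeP[v vF vE]]|->].
  have zE : z = x * pi (i c (u^-1 * v)).
    by rewrite !gmulfM !multV -vE mulKg mulKVg.
  have : z \in crossed_set coprodG pi g c :&: [set z | same_coset i pi c x z].
    by rewrite !inE gz; apply/asboolP; exists (u^-1 * v).
  rewrite gxy !inE => /orP[/eqP//|/eqP zy].
  by have := nearN u v uF vF; rewrite -zE zy eqxx.
split; last by rewrite mulVg mulg1; apply/shapeP; exists u.
have : x \in crossed_set coprodG pi g c :&: [set z | same_coset i pi c x z].
  by rewrite gxy !inE eqxx.
by rewrite !inE => /andP[].
Qed.

Lemma path_word n c p g :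
  altpath (same_coset i pi) c (pi g) p ->
  all_steps (fun c x y => exists2 s : S c, near_letter n (mk_letter s) &
    y = x * pi (i c s)) c (pi g) p ->
  exists w, [/\ size w = size p, forall t, t \in w -> near_letter n t,
    pi (g * wval i w) = last (pi g) p &
    forall d z, crossed (g * wval i w) d z = crossed g d z (+) toggled c (pi g) p d z].
Proof.
elim: p c g => [|y p IHp] c g /=.
  by move=> _ _; exists [::]; rewrite /= mulg1; split=> // d z; rewrite addbF.
move=> /and3P[_ _ yp] [[s near_s yE] stepsp].
have yE' : y = pi (g * i c s) by rewrite gmulfM.
rewrite {}yE' in yE yp stepsp *.
have [w [sw near_w pw cw]] := IHp _ _ yp stepsp.
have valE : g * (i c s * wval i w) = g * i c s * wval i w by rewrite mulgA.
exists (mk_letter s :: w); rewrite /= {1 2}/letter_val /= valE sw; split=> //.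
  by move=> t; rewrite inE => /predU1P[->//|]; exact: near_w.
by move=> d z; rewrite cw crossed_letter -gmulfM addbA.
Qed.

(** Scale 0 bounds the number of crossed edges by [s], so large girth yields a path; its steps lift
    to near letters. The resulting word has the endpoint and the chains of [h], hence lies in the
    same coset of the kernel. *)
Lemma separation_lower m L (s : R) h :
  girth_gt (same_coset i pi) L -> Num.truncn s <= L -> Num.truncn s < m ->
  (forall c, F c 0 = [fset 1]%fset) -> (forall c k, F c k != fset0) ->
  (forall c k, k < m -> {in F c k &, injective (fun s => pi (i c s))}) ->
  (total_separation m h <= s)%R ->
  exists w, [/\ size w <= Num.truncn s,
    forall t, t \in w -> near_letter (Num.truncn s).+1 t &
    (N : set G) (h^-1 * wval i w)].
Proof.
move=> gL sL sm F0 Fn0 injF seps.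
have term_ge0 c k : (0 <= (separation c k h)%:R / (#|` F c k|)%:R :> R)%R.
  by rewrite divr_ge0 ?ler0n.
have s0 : (0 <= s)%R.
  by apply: le_trans seps; do 2!apply: sumr_ge0 => ? _.
have le_s (n : nat) : (n%:R <= s)%R = (n <= Num.truncn s) by rewrite truncn_ge_nat.
have crossed_card c : #|crossed_set coprodG pi h c| = separation c 0 h.
  apply: eq_card => q; rewrite !inE /side /shape F0.
  rewrite (@eq_card _ _ [pred z | (z == q) && crossed h c z]); last first.
    move=> z; rewrite !inE [_ \in _](_ : _ = (z == q)) 1?andbC//.
    apply/mapP/eqP => [[t /fset1P-> qz]|->]; last first.
      by exists 1; rewrite ?inE// !mult1 mulVg.
    by apply: (mulgI q^-1); rewrite qz !mult1 mulVg.
  case hq: (crossed h c q); last first.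
    by rewrite eq_card0// => z; rewrite !inE; case: eqP => // ->; rewrite hq.
  rewrite (@eq_card _ _ (pred1 q)) ?card1// => z; rewrite !inE.
  by case: eqP => // ->; rewrite hq.
have card_le : #|crossed_set coprodG pi h true| + #|crossed_set coprodG pi h false|
    <= Num.truncn s.
  rewrite -le_s natrD !crossed_card; apply: le_trans seps.
  rewrite /total_separation big_bool; case: (m) sm => // m' _.
  apply: lerD; rewrite big_ord_recl /= F0 cardfs1 divr1 lerDl;
    by apply: sumr_ge0 => k _; exact: term_ge0.
have sum_h z : (z \in crossed_set coprodG pi h true) (+)
    (z \in crossed_set coprodG pi h false) = (z == 1) (+) (z == pi h).
  by rewrite !inE crossed_sum.
have [c [p [[xp p_last sp] [_ hE steps_p]]]] := path_extraction
  (same_coset_equiv i pi) gL (leq_trans card_le sL)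
  (crossed_even coprodG pi h)
  sum_h.
(* A step that is near at none of the first floor(s) + 1 scales would pay at least 1 at each of
   them, more than [s] in total. *)
have lift_step c' x y :
    crossed_set coprodG pi h c' :&: [set z | same_coset i pi c' x z] = [set x; y] ->
    exists2 t : S c', near_letter (Num.truncn s).+1 (mk_letter t) &
      y = x * pi (i c' t).
  move=> hxy; apply: contrapT => no_near.
  suff : ((Num.truncn s).+1%:R <= s)%R by rewrite le_s ltnn.
  apply: le_trans seps; rewrite /total_separation (bigD1 c')//=.
  apply: (@le_trans _ _ (\sum_(k < m) (separation c' k h)%:R / (#|` F c' k|)%:R)%R); last first.
    by rewrite lerDl; do 2!apply: sumr_ge0 => ? _.
  rewrite -(big_mkord xpredT (fun k => (separation c' k h)%:R / (#|` F c' k|)%:R)%R).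
  rewrite (big_cat_nat (leq0n _) sm)//=; apply: ler_wpDr.
    by apply: sumr_ge0 => k _; exact: term_ge0.
  rewrite -[leLHS](_ : (\sum_(0 <= k < (Num.truncn s).+1) 1)%R = _); last first.
    by rewrite big_const_nat subn0 iter_addr_0.
  rewrite !big_mkord; apply: ler_sum => k _.
  rewrite ler_pdivlMr ?ltr0n ?cardfs_gt0// mul1r ler_nat.
  apply: (separation_step (x := x) (y := y)) => //.
    by apply: injF; apply: leq_trans (ltn_ord k) sm.
  move=> u v uF vF; apply/eqP => yE; apply: no_near; exists (u^-1 * v) => //.
  by exists k => //; exists u, v.
have steps_p' : all_steps (fun c x y => exists2 s' : S c,
    near_letter (Num.truncn s).+1 (mk_letter s') & y = x * pi (i c s')) c (pi 1) p.
  rewrite mult1; elim: p c 1 steps_p {xp p_last sp hE} => //= y p IHp c x [xy /IHp ?].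
  by split=> //; exact: lift_step.
have xp' : altpath (same_coset i pi) c (pi 1) p by rewrite mult1.
have [w [sw near_w pw cw]] := path_word xp' steps_p'.
exists w; split=> //; first by rewrite sw (leq_trans sp).
rewrite mul1g in pw cw; rewrite mult1 in pw cw.
apply/cover_kerP; split=> [|d z]; first by rewrite pw p_last.
by rewrite cw crossed1 addFb -hE inE.
Qed.

End Cuts.

(** * The Hilbert space of square summable sequences *)

Section SquareSummable.
Local Open Scope classical_set_scope.
Local Open Scope ring_scope.
Context (R : realType).
Implicit Types (f g : nat -> R).

Definition sqsum_pred : pred (nat -> R) :=
  fun f => `[< exists M, forall n, \sum_(i < n) f i ^+ 2 <= M >].

Lemma sqsumP f M : (forall n, \sum_(i < n) f i ^+ 2 <= M) -> sqsum_pred f.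
Proof. by move=> fM; apply/asboolP; exists M. Qed.

Fact sqsum_submod_closed : submod_closed sqsum_pred.
Proof.
split=> [|a f g /asboolP[M fM] /asboolP[M' gM']].
  by apply: (@sqsumP _ 0) => n; rewrite big1// => i _; rewrite expr0n.
apply: (@sqsumP _ (2 * a ^+ 2 * M + 2 * M')) => n.
apply: (@le_trans _ _ (\sum_(i < n) (2 * a ^+ 2 * f i ^+ 2 + 2 * g i ^+ 2))).
  apply: ler_sum => i _.
  have -> : (a *: f + g) i = a * f i + g i by [].
  by have := sqr_ge0 (a * f i - g i); nra.
rewrite big_split/= -!mulr_sumr; apply: lerD; apply: ler_wpM2l => //.
- by rewrite mulr_ge0 ?sqr_ge0.
- exact: fM.
- exact: gM'.
Qed.

Record l2 := L2 { l2_fun :> nat -> R; l2P : sqsum_pred l2_fun }.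

HB.instance Definition _ := [isSub for l2_fun].
HB.instance Definition _ := [Choice of l2 by <:].
HB.instance Definition _ := GRing.SubChoice_isSubLmodule.Build R
  (nat -> R) sqsum_pred l2 sqsum_submod_closed.

Implicit Types u v w : l2.

Definition dot_ u v n := \sum_(i < n) u i * v i.
Definition l2_dot u v : R := limn (dot_ u v).

Lemma l2DE u v i : (u + v) i = u i + v i. Proof. by []. Qed.
Lemma l2BE u v i : (u - v) i = u i - v i. Proof. by []. Qed.

Lemma l2_eq u v : (forall i, u i = v i) -> u = v.
Proof. by move=> uv; apply/val_inj/funext. Qed.

Let sq_cvg u : cvgn (dot_ u u).
Proof.
have /asboolP[M uM] := l2P u.
apply: nondecreasing_is_cvgn.
  apply/nondecreasing_seqP => n.
  by rewrite /dot_ big_ord_recr/= lerDl -expr2 sqr_ge0.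
exists M => _ [n _ <-]; apply: le_trans (uM n).
by apply: ler_sum => i _; rewrite -expr2.
Qed.

(** Polarization reduces this to the monotone case [sq_cvg]. *)
Lemma dot_cvg u v : cvgn (dot_ u v).
Proof.
have -> : dot_ u v = (fun n => 2^-1 * (dot_ (u + v) (u + v) n -
    dot_ u u n - dot_ v v n)).
  apply/funext => n; rewrite /dot_ -!sumrB mulr_sumr; apply: eq_bigr => i _.
  by rewrite l2DE; field.
apply: is_cvgM; first exact: is_cvg_cst.
by apply: is_cvgB; [apply: is_cvgB|]; exact: sq_cvg.
Qed.

Lemma l2_dot_linear w : GRing.linear_for *%R (l2_dot ^~ w).
Proof.
move=> a u v; rewrite /l2_dot.
have -> : dot_ (a *: u + v) w = (fun n => a * dot_ u w n + dot_ v w n).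
  apply/funext => n; rewrite /dot_ mulr_sumr -big_split/=.
  apply: eq_bigr => i _.
  by transitivity ((a * u i + v i) * w i) => //; rewrite mulrDl mulrA.
have cst : cvgn (fun=> a : R) by exact: is_cvg_cst.
rewrite limD; [|by apply: is_cvgM => //; exact: dot_cvg|exact: dot_cvg].
rewrite limM ?lim_cst//; [exact: cvg_cst|exact: dot_cvg].
Qed.

Lemma l2_dotC u v : l2_dot u v = l2_dot v u.
Proof.
rewrite /l2_dot; suff -> : dot_ u v = dot_ v u by [].
by apply/funext => n; apply: eq_bigr => i _; rewrite mulrC.
Qed.

Lemma dot_le u n : dot_ u u n <= l2_dot u u.
Proof.
apply: nondecreasing_cvgn_le; last exact: dot_cvg.
apply/nondecreasing_seqP => k.
by rewrite /dot_ big_ord_recr/= lerDl -expr2 sqr_ge0.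
Qed.

Lemma l2_dot_le u M : (forall n, \sum_(i < n) u i ^+ 2 <= M) -> l2_dot u u <= M.
Proof.
move=> uM; apply: limr_le; first exact: dot_cvg.
by near=> n; have := uM n; under eq_bigr do rewrite expr2.
Unshelve. all: by end_near. Qed.

Lemma l2_dot_ge0 u : 0 <= l2_dot u u.
Proof. by apply: le_trans (dot_le u 0); rewrite /dot_ big_ord0. Qed.

Lemma l2_coord_le u i : u i ^+ 2 <= l2_dot u u.
Proof.
apply: le_trans (dot_le u i.+1); rewrite /dot_ big_ord_recr/= -expr2 lerDr.
by apply: sumr_ge0 => j _; rewrite -expr2 sqr_ge0.
Qed.

Lemma l2_dot_eq0 u : l2_dot u u = 0 -> u = 0.
Proof.
move=> u0; apply: l2_eq => i; apply/eqP.
by rewrite -sqrf_eq0 eq_le sqr_ge0 andbT -u0 l2_coord_le.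
Qed.

Let l2_bilinear : bilinear_for
  (GRing.Scale.Law.clone _ _ *%R _) (GRing.Scale.Law.clone _ _ (idfun \; *%R) _)
  l2_dot.
Proof.
split=> w a u v; first exact: l2_dot_linear.
by rewrite !(l2_dotC w); exact: l2_dot_linear.
Qed.

HB.instance Definition _ := bilinear_isBilinear.Build R l2 l2 R _ _
  l2_dot l2_bilinear.

Let l2_dot_sym (u v : l2) : l2_dot u v = (-1) ^+ false * idfun (l2_dot v u).
Proof. by rewrite expr0 mul1r l2_dotC. Qed.

HB.instance Definition _ := isHermitianSesquilinear.Build R l2 false idfun
  l2_dot l2_dot_sym.

Let l2_dot_gt0 u : u != 0 -> 0 < l2_dot u u.
Proof.
move=> u0; rewrite lt_neqAle l2_dot_ge0 andbT eq_sym.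
by apply: contra u0 => /eqP/l2_dot_eq0/eqP.
Qed.

HB.instance Definition _ := isDotProduct.Build R l2 l2_dot l2_dot_gt0.

Definition l2_norm u : R := Num.sqrt (l2_dot u u).

Lemma l2_dotDl u v w : l2_dot (u + v) w = l2_dot u w + l2_dot v w.
Proof. by have := l2_dot_linear w 1 u v; rewrite scale1r mul1r. Qed.

Lemma l2_dotZl a u w : l2_dot (a *: u) w = a * l2_dot u w.
Proof.
have := l2_dot_linear w a u 0; rewrite addr0 => ->.
have := l2_dot_linear w (-1) 0 0; rewrite scaler0 addr0 => h.
suff -> : l2_dot 0 w = 0 by rewrite addr0.
by move: h; rewrite mulN1r => ->; rewrite addNr.
Qed.

Lemma l2_cauchy_schwarz u v : l2_dot u v ^+ 2 <= l2_dot u u * l2_dot v v.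
Proof.
have [->|/l2_dot_gt0 v0] := eqVneq v 0.
  by rewrite l2_dotC -(scale0r 0) !l2_dotZl !mul0r mulr0 expr0n.
have := l2_dot_ge0 (l2_dot v v *: u + (- l2_dot u v) *: v).
rewrite l2_dotDl !l2_dotZl (l2_dotC u) (l2_dotC v (_ + _)) !l2_dotDl !l2_dotZl.
rewrite (l2_dotC v u).
set a := l2_dot u u; set b := l2_dot u v; set c := l2_dot v v in v0 *.
have -> : c * (c * a + - b * b) + - b * (c * b + - b * c) =
  c * (a * c - b ^+ 2) by ring.
by rewrite pmulr_rge0// subr_ge0.
Qed.

Let l2_normD u v : l2_norm (u + v) <= l2_norm u + l2_norm v.
Proof.
rewrite -(@ler_pXn2r _ 2)// ?nnegrE ?addr_ge0 ?sqrtr_ge0//.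
rewrite sqrrD !sqr_sqrtr ?l2_dot_ge0// l2_dotDl !(l2_dotC _ (u + v)) !l2_dotDl.
rewrite (l2_dotC v u).
suff : l2_dot u v <= l2_norm u * l2_norm v by rewrite mulr2n; lra.
apply: le_trans (ler_norm _) _.
rewrite -sqrtr_sqr /l2_norm -sqrtrM ?l2_dot_ge0//.
by rewrite ler_wsqrtr// l2_cauchy_schwarz.
Qed.

Let l2_normZ (a : R) u : l2_norm (a *: u) = `|a| * l2_norm u.
Proof.
rewrite /l2_norm l2_dotZl l2_dotC l2_dotZl mulrA -expr2.
by rewrite sqrtrM ?sqr_ge0// sqrtr_sqr.
Qed.

Let l2_norm0_eq0 u : l2_norm u = 0 -> u = 0.
Proof.
move=> /eqP; rewrite sqrtr_eq0 => u0; apply: l2_dot_eq0.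
by apply/eqP; rewrite eq_le u0 l2_dot_ge0.
Qed.

HB.instance Definition _ := Lmodule_isNormed.Build R l2
  l2_normD l2_normZ l2_norm0_eq0.

Lemma l2_sqr_norm u : `|u| ^+ 2 = l2_dot u u.
Proof. by rewrite sqr_sqrtr ?l2_dot_ge0. Qed.

Lemma l2_norm_le u (M : R) : 0 <= M ->
  (forall n, \sum_(i < n) u i ^+ 2 <= M ^+ 2) -> `|u| <= M.
Proof.
move=> M0 uM; rewrite -(@ler_pXn2r _ 2)// ?nnegrE// l2_sqr_norm.
exact: l2_dot_le.
Qed.

Lemma l2_coord_norm u i : `|u i| <= `|u|.
Proof.
rewrite -(@ler_pXn2r _ 2)// ?nnegrE// l2_sqr_norm real_normK ?num_real//.
exact: l2_coord_le.
Qed.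

(** The limit is taken coordinatewise. Each finite partial sum of squares passes to the limit along
    [F], so the estimate is uniform in [n] and gives both membership in [l2] and convergence in
    norm. *)
Lemma l2_complete (F : set_system l2) : ProperFilter F -> cauchy F -> cvg F.
Proof.
move=> FF /cauchyP Fc; apply/cvg_ex.
have xP i : exists x : R, (fun u : l2 => u i) @ F --> x.
  apply/cvg_ex; apply: (@cauchy_cvg R); apply/cauchyP => e e0.
  have [v Fv] := Fc _ e0; exists (v i).
  rewrite /nbhs/=; apply: filterS Fv => u.
  rewrite -!ball_normE/= => vu.
  by rewrite -l2BE (le_lt_trans (l2_coord_norm _ _)).
pose x i := projT1 (cid (xP i)).
have xE i : (fun u : l2 => u i) @ F --> x i := projT2 (cid (xP i)).
have tail e : 0 < e -> exists v : l2, F (ball v e) /\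
    forall u : l2, ball v e u ->
    forall n, \sum_(i < n) (u i - x i) ^+ 2 <= (2 * e) ^+ 2.
  move=> e0; have [v Fv] := Fc _ e0; exists v; split=> // u vu n.
  have cv : (fun w : l2 => \sum_(i < n) (u i - w i) ^+ 2) @ F -->
      \sum_(i < n) (u i - x i) ^+ 2.
    apply: cvg_big => [|i _]; first exact: add_continuous.
    rewrite expr2; under eq_fun do rewrite expr2.
    by apply: cvgM; apply: cvgB; (exact: cvg_cst || exact: xE).
  rewrite -(cvg_lim _ cv)//; apply: limr_le; first by apply/cvg_ex; eexists; exact: cv.
  apply: filterS Fv => w vw.
  have uw : `|u - w| <= 2 * e.
    move: vu vw; rewrite -!ball_normE/= => vu vw.
    have -> : u - w = (v - w) - (v - u) by rewrite opprB [RHS]addrC subrKA.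
    rewrite (le_trans (ler_normB _ _))// mulr_natl mulr2n lerD// ltW//.
  have -> : \sum_(i < n) (u i - w i) ^+ 2 = dot_ (u - w) (u - w) n.
    by apply: eq_bigr => i _; rewrite l2BE expr2.
  rewrite (le_trans (dot_le _ _))// -l2_sqr_norm.
  by rewrite lerXn2r// nnegrE// mulr_ge0// ltW.
have xl2 : sqsum_pred x.
  have [v [Fv vx]] := tail 1 ltr01.
  have vP : sqsum_pred (l2_fun v - x).
    by apply: sqsumP => n; apply: vx; apply: ballxx.
  have -> : x = l2_fun (v - L2 vP); last exact: l2P.
  by apply/funext => i /=; rewrite opprB addrC subrK.
exists (L2 xl2); apply/cvgrPdist_le => e e0.
have e2 : 0 < e / 2 by rewrite divr_gt0.
have [v [Fv vx]] := tail _ e2.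
apply: filterS Fv => u vu; rewrite distrC; apply: l2_norm_le; first exact: ltW.
by move=> n; have := vx _ vu n; rewrite mulrC divfK.
Qed.

HB.instance Definition _ := Uniform_isComplete.Build l2 l2_complete.

Lemma l2_hilbert : is_hilbert l2.
Proof. by exists l2_dot; exact: l2_sqr_norm. Qed.

End SquareSummable.

(** * Coarse embeddings of box spaces *)

Section FiniteBounds.
Local Open Scope classical_set_scope.
Local Open Scope ring_scope.
Context (R : realType).

Lemma finite_ubound (T : Type) (D : set T) (h : T -> R) :
  finite_set D -> exists M, forall x, D x -> h x <= M.
Proof.
move=> /(finite_image h) /finite_seqP[s sE].
exists (\big[Num.max/0]_(r <- s) r) => x Dx.
have : [set` s] (h x) by rewrite -sE; exists x.
by move=> /= xs; exact: (le_bigmax_seq 0 _ xpredT id xs).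
Qed.

Lemma finite_ubound2 (T : Type) (D : set T) (h : T -> T -> R) :
  finite_set D -> exists M, forall x y, D x -> D y -> h x y <= M.
Proof.
move=> fD; pose hx x := projT1 (cid (finite_ubound (h x) fD)).
have hxP x y : D y -> h x y <= hx x := projT2 (cid (finite_ubound (h x) fD)) y.
have [M MP] := finite_ubound hx fD.
by exists M => x y Dx Dy; apply: le_trans (hxP _ _ Dy) (MP _ Dx).
Qed.

(** For n < m the gap is at least 2^(m-1) >= m. Pairs of points in different components at bounded
    distance thus lie in finitely many components. *)
Lemma pow2_gap (n m : nat) (t : R) : n <> m -> `|2 ^+ n - 2 ^+ m| <= t ->
  (n <= Num.truncn t)%N /\ (m <= Num.truncn t)%N.
Proof.
move=> nm h; have t0 : 0 <= t by apply: le_trans h.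
rewrite !truncn_ge_nat//.
have wlog_ (k j : nat) : (k < j)%N -> j%:R <= 2 ^+ j - 2 ^+ k :> R.
  case: j => // j; rewrite ltnS => kj.
  have : (2 : R) ^+ k <= 2 ^+ j by rewrite ler_eXn2l// ltr1n.
  have : j.+1%:R <= 2 ^+ j :> R by rewrite -natrX ler_nat ltn_expl.
  by rewrite exprS; lra.
wlog lt_nm : n m nm h / (n < m)%N => [th|].
  have [lt|lt|] := ltngtP n m; first exact: th.
    by rewrite distrC in h; have [] := th _ _ (nesym nm) h lt.
  by move=> eq_nm; case: nm.
rewrite distrC in h; have mt : m%:R <= t.
  by apply: le_trans (wlog_ _ _ lt_nm) (le_trans (ler_norm _) h).
by split=> //; apply: le_trans mt; rewrite ler_nat ltnW.
Qed.

End FiniteBounds.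

Section CoarseEmbedding.
Local Open Scope classical_set_scope.
Local Open Scope ring_scope.

Lemma coarse_embedding_bounds (R : realType) (X Y : Type)
    (dX : X -> X -> R) (dY : Y -> Y -> R) (F : X -> Y) :
  (forall x x', 0 <= dX x x') -> (forall y y', 0 <= dY y y') ->
  (forall t, exists C, forall x x', dX x x' <= t -> dY (F x) (F x') <= C) ->
  (forall s, exists T, forall x x', dY (F x) (F x') <= s -> dX x x' <= T) ->
  coarse_embedding dX dY F.
Proof.
move=> dX0 dY0 upper lower.
(* The controls are t + sup U(t), the summand t making it proper, and inf L(t). The extra elements
   keep both sets nonempty, and let inf L(t) tend to infinity even when [X] is bounded. *)
pose U t := [set r | r = 0 \/ exists x x', dX x x' <= t /\ r = dY (F x) (F x')].
pose L t := [set r | (0 <= r /\ t <= r) \/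
  exists x x', t <= dX x x' /\ r = dY (F x) (F x')].
have U0 t : U t !=set0 by exists 0; left.
have Uub t : has_ubound (U t).
  have [C CP] := upper t; exists (Num.max C 0) => _ [->|[x [x' [le ->]]]].
    by rewrite le_max lexx orbT.
  by rewrite le_max CP.
have L0 t : L t !=set0.
  by exists `|t|; left; split; rewrite ?normr_ge0 ?ler_norm.
have Llb t : has_lbound (L t).
  by exists 0 => _ [[]//|[x [x' [_ ->]]]].
exists (fun t => inf (L t)), (fun t => t + sup (U t)); split.
- split=> [t _|s t _ st|].
  + by apply: lb_le_inf => // _ [[]//|[x [x' [_ ->]]]].
  + apply: lb_le_inf => // r Lr; apply: ge_inf => //.
    case: Lr => [[r0 tr]|[x [x' [tx ->]]]]; first by left; split=> //; exact: le_trans tr.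
    by right; exists x, x'; split=> //; exact: le_trans tx.
  + apply/cvgryPge => A; have [T TP] := lower A.
    near=> t; apply: lb_le_inf => // r [[_ tr]|[x [x' [tx ->]]]].
      by apply: le_trans tr; near: t; apply: nbhs_pinfty_ge; rewrite num_real.
    rewrite leNgt; apply/negP => /ltW/TP xT.
    have : T < t by near: t; apply: nbhs_pinfty_gt; rewrite num_real.
    by rewrite ltNge (le_trans tx).
- split=> [t t0|s t s0 st|].
  + by rewrite addr_ge0//; apply: ub_le_sup => //; left.
  + apply: lerD => //; apply: ge_sup => // r Ur; apply: ub_le_sup => //.
    case: Ur => [->|[x [x' [xs ->]]]]; first by left.
    by right; exists x, x'; split=> //; exact: le_trans st.
  + apply/cvgryPge => A; near=> t.
    have : A <= t by near: t; apply: nbhs_pinfty_ge; rewrite num_real.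
    by move/le_trans; apply; rewrite lerDl; apply: ub_le_sup => //; left.
- move=> x x'; apply/andP; split.
    by apply: ge_inf => //; right; exists x, x'.
  apply: (@le_trans _ _ (sup (U (dX x x')))); last by rewrite lerDr.
  by apply: ub_le_sup => //; right; exists x, x'.
Unshelve. all: by end_near. Qed.

End CoarseEmbedding.

(** * Finite families as square summable sequences *)

Section FiniteVectors.
Local Open Scope classical_set_scope.
Local Open Scope ring_scope.
Context (R : realType).

(** Coordinate 0 is reserved for a number that will tell the components of the box space apart. *)
Definition vec_fun (c : R) (J : finType) (a : J -> R) (n : nat) : R :=
  if n is k.+1 then
    if insub k : option 'I_#|J| is Some i then a (enum_val i) else 0
  else c.

Lemma sum_vec c (J : finType) (a : J -> R) n :
  \sum_(i < (n + #|J|).+1) vec_fun c a i ^+ 2 = c ^+ 2 + \sum_j a j ^+ 2.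
Proof.
rewrite big_ord_recl/=; congr (_ + _).
rewrite -(big_mkord predT (fun i => vec_fun c a i.+1 ^+ 2)).
rewrite (big_cat_nat (n := #|J|))//=; last by rewrite leq_addl.
rewrite [X in _ + X]big1_seq ?addr0; last first.
  move=> i; rewrite mem_index_iota => /andP[_ /andP[Ji _]].
  by rewrite insubF ?expr0n// ltnNge Ji.
rewrite big_mkord (reindex (@enum_val _ J)) /=; last first.
  by apply: onW_bij; exact: enum_val_bij.
by apply: eq_bigr => i _; rewrite valK.
Qed.

Lemma sum_vec_le c (J : finType) (a : J -> R) n :
  \sum_(i < n) vec_fun c a i ^+ 2 <= c ^+ 2 + \sum_j a j ^+ 2.
Proof.
rewrite -(sum_vec c a n).
rewrite -(big_mkord predT (fun i => vec_fun c a i ^+ 2)).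
rewrite -(big_mkord predT (fun i => vec_fun c a i ^+ 2)).
rewrite [leRHS](big_cat_nat (n := n))//=; last by rewrite -addnS leq_addr.
by rewrite lerDl sumr_ge0// => i _; rewrite sqr_ge0.
Qed.

Definition vec c (J : finType) (a : J -> R) : l2 R := L2 (sqsumP (sum_vec_le c a)).

Lemma vecB c d (J : finType) (a b : J -> R) :
  vec c a - vec d b = vec (c - d) (fun j => a j - b j).
Proof.
apply: l2_eq => i; rewrite l2BE /=; case: i => //= i.
by case: insubP => //= _; rewrite subr0.
Qed.

Lemma vec_norm c (J : finType) (a : J -> R) :
  `|vec c a| ^+ 2 = c ^+ 2 + \sum_j a j ^+ 2.
Proof.
rewrite l2_sqr_norm; apply/eqP; rewrite eq_le; apply/andP; split.
  by apply: l2_dot_le => n; exact: sum_vec_le.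
apply: le_trans (dot_le _ (0 + #|J|).+1).
by rewrite -(sum_vec c a 0); apply: ler_sum => i _; rewrite expr2.
Qed.

End FiniteVectors.

Section BoxSpace.
Local Open Scope classical_set_scope.
Local Open Scope ring_scope.
Context (R : realType) (G : groupType) (l : properLength R G).
Context (N : nat -> finIndexNormal G).


Definition qcoset (M : finIndexNormal G) (g : G) : quotient_space l M :=
  exist _ (Defs.lcoset M g) (mem_set (imageT (Defs.lcoset M) g)).

Lemma qcosetP (M : finIndexNormal G) (x : quotient_space l M) :
  exists g, qcoset M g = x.
Proof.
have [g _ gx] : Defs.lcosets M (val x) by exact: set_mem (valP x).
by exists g; apply: val_inj.
Qed.

Lemma finite_quotient_space (M : finIndexNormal G) :
  finite_set [set: quotient_space l M].
Proof.
have -> : [set: quotient_space l M] = val @^-1` (Defs.lcosets M).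
  by apply/seteqP; split=> // x _ /=; exact: set_mem (valP x).
apply: finite_preimage; last exact: fin_index.
by move=> x y _ _; exact: val_inj.
Qed.

Lemma mdist_qcosetE (M : finIndexNormal G) g h :
  mdist (qcoset M g) (qcoset M h) = inf [set l (g^-1 * h * k)%g | k in M].
Proof. exact: quotient_distE. Qed.

Let values_lbound (M : finIndexNormal G) g h :
  has_lbound [set l (g^-1 * h * k)%g | k in M].
Proof. by exists 0 => _ [k _ <-]; have [] := len_length l. Qed.

Lemma mdist_qcoset_le (M : finIndexNormal G) g h k : (M : set G) k ->
  mdist (qcoset M g) (qcoset M h) <= l (g^-1 * h * k)%g.
Proof. by move=> Mk; rewrite mdist_qcosetE; apply: ge_inf => //; exists k. Qed.

Lemma mdist_qcoset_lt (M : finIndexNormal G) g h t :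
  mdist (qcoset M g) (qcoset M h) < t ->
  exists2 k, (M : set G) k & l (g^-1 * h * k)%g < t.
Proof.
rewrite mdist_qcosetE -subr_gt0 => lt_t.
have hi : has_inf [set l (g^-1 * h * k)%g | k in M].
  split=> //; exists (l (g^-1 * h * 1)%g), 1%g => //.
  by have [] := fin_subgroup M.
have [_ [k Mk <-]] := inf_adherent lt_t hi.
by rewrite addrC subrK => kt; exists k.
Qed.

Section Embedding.
Context (I : nat -> finType) (f : forall n, G -> I n -> R).
Hypothesis f_const : forall n g h i, (N n : set G) h -> @f n (g * h)%g i = f g i.
Hypothesis f_upper : forall t, exists C, forall n g h, l (g^-1 * h)%g <= t ->
  \sum_i (@f n g i - @f n h i) ^+ 2 <= C.
Hypothesis f_lower : forall s, exists T n0, forall n g h, (n0 <= n)%N ->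
  \sum_i (@f n g i - @f n h i) ^+ 2 <= s ->
  exists2 k, (N n : set G) k & l (g^-1 * h * k)%g <= T.

(** The first coordinate 2^n keeps the images of different components apart. Pairs in different
    components at bounded distance, before or after mapping, lie in a finite set by [pow2_gap], as
    do the components below [n0]; all other pairs are covered by the hypotheses on [f]. *)
Lemma box_space_embeds (X : metricType R) :
  is_box_space l N X -> coarsely_embeds_into_hilbert X.
Proof.
move=> [p [phiP [rho [_ rho_mono _] rhoP] _]].
pose phi n := projT1 (cid (phiP n)).
have phi_range n : range (phi n) = p @^-1` [set n].
  by have [] := projT2 (cid (phiP n)).
have phi_isom n x y : mdist (phi n x) (phi n y) = mdist x y.
  by have [_] := projT2 (cid (phiP n)); apply.
have repP x : exists g, phi (p x) (qcoset (N (p x)) g) = x.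
  have : (p @^-1` [set p x]) x by [].
  rewrite -phi_range => -[y _ yx]; have [g gy] := qcosetP y; exists g.
  by rewrite gy.
pose rep x := projT1 (cid (repP x)).
have repE x : phi (p x) (qcoset (N (p x)) (rep x)) = x := projT2 (cid (repP x)).
pose F x := vec (2 ^+ p x) (f (n := p x) (rep x)).
have FE n x : p x = n -> F x = vec (2 ^+ n) (f (n := n) (rep x)) by move=> <-.
have xE n x : p x = n -> phi n (qcoset (N n) (rep x)) = x by move=> <-.
have dE n x y : p x = n -> p y = n ->
    mdist x y = mdist (qcoset (N n) (rep x)) (qcoset (N n) (rep y)).
  by move=> px py; rewrite -phi_isom (xE _ _ px) (xE _ _ py).
have fin n0 : finite_set [set x | (p x <= n0)%N].
  apply: (@sub_finite_set _ _ (\bigcup_(n in `I_n0.+1) range (phi n))).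
    by move=> x xn; exists (p x) => //; rewrite phi_range.
  apply: bigcup_finite; first exact: finite_II.
  by move=> n _; apply: finite_image; exact: finite_quotient_space.
exists (l2 R); first exact: l2_hilbert.
exists F; apply: coarse_embedding_bounds => //.
- by move=> x y; exact: mdist_ge0.
- move=> t; have [C CP] := f_upper (t + 1).
  have [C' CP'] := finite_ubound2 (fun x y => `|F x - F y|)
    (fin (Num.truncn (rho t))).
  (* [C] bounds the square of a norm, and a number is at most its square plus 1. *)
  exists (Num.max (C + 1) C') => x y xyt; rewrite le_max; apply/orP.
  have [pxy|/eqP pxy] := eqVneq (p x) (p y); last first.
    right.
    have [nx ny] := pow2_gap pxy (le_trans (rhoP x y)
      (rho_mono _ _ (mdist_ge0 _ _) xyt)).
    exact: CP'.
  left; rewrite (FE _ _ pxy) (FE (p y) y)// vecB.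
  have : mdist x y < t + 1 by rewrite (le_lt_trans xyt)// ltrDl.
  rewrite (dE (p y))//.
  move=> /mdist_qcoset_lt[k Nk /ltW kt].
  have := CP (p y) (rep x) (rep y * k)%g; rewrite mulgA => /(_ kt).
  under eq_bigr => i _ do rewrite f_const//.
  move: (vec_norm (2 ^+ p y - 2 ^+ p y) (fun i : I (p y) => f (rep x) i - f (rep y) i)).
  rewrite subrr expr0n add0r => <-.
  have := normr_ge0 (vec 0 (fun i : I (p y) => f (rep x) i - f (rep y) i)).
  nra.
- move=> s; have [T [n0 TP]] := f_lower (s ^+ 2).
  have [T' TP'] := finite_ubound2 (fun x y => mdist x y)
    (fin (maxn n0 (Num.truncn s))).
  exists (Num.max T T') => x y xys; rewrite le_max; apply/orP.
  have [pxy|/eqP pxy] := eqVneq (p x) (p y); last first.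
    right.
    have Fxy : `|2 ^+ p x - 2 ^+ p y| <= s.
      apply: le_trans xys; apply: le_trans (l2_coord_norm (F x - F y) 0).
      by rewrite l2BE.
    have [nx ny] := pow2_gap pxy Fxy.
    by apply: TP' => /=; rewrite leq_max ?nx ?ny orbT.
  have [n0y|/ltnW yn0] := leqP n0 (p y); last first.
    by right; apply: TP' => /=; rewrite leq_max ?pxy yn0.
  left; rewrite (dE (p y))//.
  have [|k Nk kT] := TP (p y) (rep x) (rep y) n0y; last first.
    exact: le_trans (mdist_qcoset_le _ _ Nk) kT.
  move: xys; rewrite (FE _ _ pxy) (FE (p y) y)// vecB subrr => xys.
  have := vec_norm 0 (fun i : I (p y) => f (rep x) i - f (rep y) i).
  rewrite expr0n add0r => <-.
  by rewrite lerXn2r// nnegrE// (le_trans _ xys).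
Qed.

End Embedding.
End BoxSpace.

(** * Existence of box spaces *)

Section BoxSpaceExists.
Local Open Scope classical_set_scope.
Local Open Scope ring_scope.
Context (R : realType) (G : groupType) (l : properLength R G).
Context (N : nat -> finIndexNormal G).

Definition box_union : Type := {n : nat & quotient_space l (N n)}.

HB.instance Definition _ := Choice.on box_union.

Let pt n (x : quotient_space l (N n)) : box_union := existT _ n x.

Let diamP n : exists M : R,
  forall x y : quotient_space l (N n), mdist x y <= M.
Proof.
have [M MP] := finite_ubound2 (fun x y => mdist x y) (finite_quotient_space l (N n)).
by exists M => x y; exact: MP.
Qed.

(** With c n + c m as distance between components, the powers of 2 dominate |2^n - 2^m| and the
    diameters give the triangle inequality through another component. *)
Let c n : R := 2 ^+ n + projT1 (cid (diamP n)).

Let c_ge n (x y : quotient_space l (N n)) : mdist x y + 2 ^+ n <= c n.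
Proof. by rewrite addrC lerD2l (projT2 (cid (diamP n))). Qed.

Let d (x y : box_union) : R :=
  if tag x == tag y then mdist (tagged x) (tagged_as x y)
  else c (tag x) + c (tag y).

Let d_same n (x y : quotient_space l (N n)) :
  d (pt x) (pt y) = mdist x y.
Proof. by rewrite /d/= eqxx (tagged_asE (u := pt x) y). Qed.

Let d_diff (x y : box_union) : tag x <> tag y -> d x y = c (tag x) + c (tag y).
Proof. by move=> /eqP/negbTE xy; rewrite /d xy. Qed.

Let c_gt0 (x : box_union) : 0 < c (tag x).
Proof.
by apply: lt_le_trans (c_ge (tagged x) (tagged x)); rewrite mdistxx add0r exprn_gt0.
Qed.

Let dxx (x : box_union) : d x x = 0.
Proof. by case: x => n x; rewrite d_same mdistxx. Qed.

Let d_eq0 (x y : box_union) : d x y = 0 -> x = y.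
Proof.
have [|xy] := eqVneq (tag x) (tag y); last first.
  by rewrite d_diff; [move=> /eqP; rewrite gt_eqF// addr_gt0|exact/eqP].
case: x y => n x [m y] /= nm; case: m / nm y => y.
by rewrite d_same => /mdist_positivity ->.
Qed.

Let d_sym (x y : box_union) : d x y = d y x.
Proof.
have [|/eqP xy] := eqVneq (tag x) (tag y); last first.
  by rewrite !d_diff// 1?addrC//; exact: nesym.
case: x y => n x [m y] /= nm; case: m / nm y => y.
by rewrite !d_same metric_sym.
Qed.

Let d_le (x y : box_union) : tag x = tag y -> d x y <= c (tag x).
Proof.
case: x y => n x [m y] /= nm; case: m / nm y => y.
by rewrite d_same; apply: le_trans (c_ge x y); rewrite lerDl exprn_ge0.
Qed.

Let d_triangle (y x z : box_union) : d x z <= d x y + d y z.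
Proof.
have c0 (u : box_union) : 0 <= c (tag u) by exact/ltW/c_gt0.
have d0 u v : 0 <= d u v.
  rewrite /d; case: ifP => _; first exact: mdist_ge0.
  by rewrite addr_ge0.
have [xy|/eqP xy] := eqVneq (tag x) (tag y);
    have [yz|/eqP yz] := eqVneq (tag y) (tag z).
- case: x y z xy yz {d0} => n x [m y] [k z] /= xy.
  case: m / xy y => y yz; case: k / yz z => z.
  by rewrite !d_same; exact: metric_triangle.
- rewrite d_diff ?xy// (d_diff yz) -[leLHS]add0r lerD2r//.
- rewrite d_diff -?yz// (d_diff xy) yz -[leLHS]addr0 lerD2l//.
- rewrite (d_diff xy) (d_diff yz); have [xz|/eqP xz] := eqVneq (tag x) (tag z).
    apply: (le_trans (d_le xz)); rewrite -addrA lerDl.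
    exact: addr_ge0 (c0 y) (addr_ge0 (c0 y) (c0 z)).
  by rewrite d_diff//; have := c0 y; lra.
Qed.

HB.instance Definition _ := isMetric.Build R box_union dxx d_eq0 d_sym d_triangle.

Lemma box_space_exists : exists X : metricType R, is_box_space l N X.
Proof.
exists box_union, (fun x : box_union => tag x).
have dE (x y : box_union) : mdist x y = d x y by [].
have bounded (S : set box_union) n : S `<=` [set x | tag x = n] -> mbounded S.
  move=> Sn; exists (c n) => x y /Sn/= xn /Sn/= yn.
  by rewrite dE -xn d_le// yn.
split.
- move=> n; exists (@pt n); split=> [|x y]; last by rewrite dE d_same.
  apply/seteqP; split=> [_ [x _ <-] //|[m x] /= mn].
  by case: n / mn => //; exists x.
- exists (fun t => t).
    by split=> //; apply: cvg_id.
  move=> x y; rewrite dE; have [xy|/eqP xy] := eqVneq (tag x) (tag y).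
    rewrite xy subrr normr0 -dE; exact: mdist_ge0.
  rewrite d_diff// (le_trans (ler_normB _ _))// !ger0_norm ?exprn_ge0//.
  apply: lerD.
    by apply: le_trans (c_ge (tagged x) (tagged x)); rewrite lerDr mdist_ge0.
  by apply: le_trans (c_ge (tagged y) (tagged y)); rewrite lerDr mdist_ge0.
- by move=> r n m _ _; apply: (bounded _ n) => x /= [].
Qed.

End BoxSpaceExists.

(** * Box spaces of free products *)

Section Coproduct.
Local Open Scope group_scope.
Context (R : realType) (S : bool -> groupType) (G : groupType).
Context (i : forall c, {multiplicative S c -> G}).
Hypothesis coprodG : is_coproduct i.
Context (l : properLength R G).
Hypothesis amS : forall c, amenable R (S c).
Hypothesis rfS : forall c, residually_finite (S c).

(** The letters of length at most [k] in [G] are finitely many, since [l] is proper and [i c]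
    injective. The shift of index frees scale 0 for {1}. *)
Lemma folner_sequence : exists F : forall c, nat -> {fset S c},
  [/\ forall c, F c 0 = [fset 1]%fset, forall c k, F c k != fset0 &
    forall c k (s : S c), (l (i c s) <= k%:R)%R ->
      2 ^ k * defect F k.+1 s <= #|` F c k.+1|].
Proof.
have FP c k : exists F : {fset S c}, F != fset0 /\
    forall s : S c, (l (i c s) <= k%:R)%R ->
    2 ^ k * #|` [fset x in F | (x * s)%g \notin F]%fset| <= #|` F|.
  have : finite_set ((i c) @^-1` [set g | (l g <= k%:R)%R])%classic.
    apply: finite_preimage; last exact: len_proper.
    by move=> x y _ _; exact: coproduct_inj.
  move=> /finite_seqP[s sE].
  have [F [F0 FE]] := right_folner (amS c) s (2 ^ k).
  exists F; split=> // t lt; apply: FE.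
  by have : [set` s]%classic t by rewrite -sE.
pose F c k := if k is k'.+1 then projT1 (cid (FP c k')) else [fset 1]%fset.
exists F; split=> // [c [|k]|c k s ls].
- by rewrite -cardfs_gt0 cardfs1.
- by have [] := projT2 (cid (FP c k)).
- by have [_] := projT2 (cid (FP c k)); exact.
Qed.

Context (F : forall c, nat -> {fset S c}).
(* The walls of scale 0 count the crossed edges. *)
Hypothesis F0 : forall c, F c 0 = [fset 1]%fset.
Hypothesis Fn0 : forall c k, F c k != fset0.
Hypothesis F_folner : forall c k (s : S c), (l (i c s) <= k%:R)%R ->
  2 ^ k * defect F k.+1 s <= #|` F c k.+1|.

Lemma defect_summable c (s : S c) : exists C : R, forall m,
  (\sum_(k < m) (defect F k s)%:R / (#|` F c k|)%:R <= C)%R.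
Proof.
pose term k : R := ((defect F k s)%:R / (#|` F c k|)%:R)%R.
pose k0 := (Num.truncn (l (i c s))).+1.
have F_gt0 k : (0 < (#|` F c k|)%:R :> R)%R by rewrite ltr0n cardfs_gt0.
have term1 k : (term k <= 1)%R.
  rewrite ler_pdivrMr// mul1r ler_nat; apply: fsubset_leq_card.
  by apply/fsubsetP => x; rewrite !inE => /andP[].
have term2 k : k0 <= k -> (term k.+1 <= 2 * 2^-1 ^+ k.+1)%R.
  move=> k0k; rewrite exprS mulrA divff ?mul1r// exprVn.
  rewrite ler_pdivrMr// ler_pdivlMl ?exprn_gt0// -natrX -natrM ler_nat.
  apply: F_folner; apply/ltW/(lt_le_trans (truncnS_gt _)).
  by rewrite ler_nat.
exists (k0.+1%:R + 4)%R => m.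
(* The minimum counts the first terms, each at most 1; 4 - 4 * 2^-m is the sum of 2 * 2^-k over k <
   m, which dominates the others. *)
suff : (\sum_(k < m) term k <= (minn m k0.+1)%:R + 4 - 4 * 2^-1 ^+ m)%R.
  move=> /le_trans; apply.
  have : ((minn m k0.+1)%:R <= k0.+1%:R :> R)%R by rewrite ler_nat geq_minr.
  have : (0 <= 2^-1 ^+ m :> R)%R by rewrite exprn_ge0.
  lra.
elim: m => [|m IHm].
  by rewrite big_ord0 min0n expr0; lra.
rewrite big_ord_recr /=; have [mk|km] := leqP m k0.
  have -> : minn m.+1 k0.+1 = (minn m k0.+1).+1.
    by rewrite (minn_idPl _) ?(minn_idPl _)// ltnW.
  have := term1 m; have : (0 <= 2^-1 ^+ m :> R)%R by rewrite exprn_ge0.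
  by move: IHm; rewrite exprS -natr1; lra.
have -> : minn m.+1 k0.+1 = minn m k0.+1.
  by rewrite !(minn_idPr _)// ltnW.
have : (term m <= 2 * 2^-1 ^+ m)%R by case: (m) km => // m' /term2.
by move: IHm; rewrite exprS; lra.
Qed.

Lemma separating_pair (s : forall c, seq (S c)) :
  exists (H : finGroupType) (a : forall c, {multiplicative S c -> H}),
    forall c, {in s c, forall x, x != 1 -> a c x != 1}.
Proof.
have [H [f fs]] := residually_finite_seq (@rfS true) (s true).
have [H' [f' fs']] := residually_finite_seq (@rfS false) (s false).
have fM : {morph (fun x => (f x, 1) : H * H') : x y / x * y}.
  by move=> x y; rewrite gmulfM; congr (_, _); rewrite mulg1.
have fM' : {morph (fun x => (1, f' x) : H * H') : x y / x * y}.
  by move=> x y; rewrite gmulfM; congr (_, _); rewrite mulg1.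
exists (H * H')%type, (fun c => match c with true => mult_of fM | false => mult_of fM' end).
case=> x xs x1; rewrite mult_ofE.
  by apply: contra (fs x xs x1) => /eqP[->].
by apply: contra (fs' x xs x1) => /eqP[->].
Qed.

(** The clauses serve, in order, [path_extraction], [separation_step] and the triviality of the
    intersection. *)
Definition good_quotient n (Kp : {K : finGroupType & {multiplicative G -> K}}) :=
  [/\ girth_gt (same_coset i (projT2 Kp)) n,
    forall c k, k < n.+1 -> {in F c k &, injective (fun s => projT2 Kp (i c s))} &
    forall g, (l g <= n%:R :> R)%R -> g != 1 -> projT2 Kp g != 1].

(** Each clause says that certain alternating words survive in [K]: lifts of short closed paths,
    single letters x^-1 y, and reduced words of the ball of radius [n]. [H] keeps the relevant
    letters nontrivial, and [L] exceeds the lengths that occur. *)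
Lemma good_quotient_exists n : exists Kp, good_quotient n Kp.
Proof.
pose om g := projT1 (cid2 (reduced_word coprodG g)).
have omr g : reduced (om g) by rewrite /om; case: cid2.
have omE g : wval i (om g) = g by rewrite /om; case: cid2.
have /finite_seqP[b bE] := len_proper l n%:R%R.
have bP g : (l g <= n%:R :> R)%R -> g \in b.
  by move=> lg; have : [set` b]%classic g by rewrite -bE.
pose letters : seq (letter S) := flatten [seq om g | g <- b].
pose lc c : seq (S c) := pmap
  (fun t : letter S => match tag t =P c with
    | ReflectT e => Some (ecast x (S x) e (tagged t)) | ReflectF _ => None end) letters.
pose ds c : seq (S c) := flatten [seq [seq x^-1 * y | x <- F c k, y <- F c k] | k <- iota 0 n.+1].
have [H [a aP]] := separating_pair (fun c => lc c ++ ds c).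
pose L := n.+1 + \max_(g <- b) size (om g).
have [K [pi [pi_girth pi_ker]]] := girth_quotient coprodG a L.
have pi_a c (s : S c) : pi (i c s) != 1 -> a c s != 1.
  by apply: contra_neq => /pi_ker.
have a_pi c (s : S c) : a c s != 1 -> pi (i c s) != 1.
  move=> as1; have := pi_girth [:: mk_letter s]; rewrite /= mulg1 as1.
  by apply.
exists (existT _ K pi); split=> /= [c x p|c k kn x y xF yF pxy|g lg g1].
- move=> /andP[p0 pn] xp.
  (* The dummy letter in front records, for the induction, that a nonempty [w] begins with color
     [c]. *)
  have [w [sw aw altw lastE]] : exists w, [/\ size w = size p,
      all (fun t => a (tag t) (tagged t) != 1) w,
      alternating_word (mk_letter (1 : S (~~ c)) :: w) &
      last x p = x * pi (wval i w)].
    elim: p c x xp {p0 pn} => [|y p IHp] c x /=.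
      by exists [::]; rewrite /= mult1 mulg1.
    move=> /and3P[xy /asboolP[s yE] /IHp[w [sw aw altw lastE]]].
    exists (mk_letter s :: w); rewrite /= sw lastE; split=> //.
    + rewrite aw andbT; apply: pi_a; apply: contraNneq xy => s1.
      by rewrite yE s1 mulg1.
    + apply/andP; split; first by case: (c).
      by case: (w) altw => //= t w' /andP[]; rewrite negbK => ->.
    + by rewrite gmulfM mulgA yE.
  rewrite lastE -{2}[x]mulg1 (inj_eq (mulgI x)); apply: pi_girth => //.
    by rewrite sw p0 (leq_trans pn)// /L; lia.
  exact: path_sorted altw.
- apply: (mulgI x^-1); rewrite mulVg; apply/esym/eqP; apply: contraT => xy1.
  have /aP/(_ xy1)/a_pi : x^-1 * y \in lc c ++ ds c.
    rewrite mem_cat; apply/orP; right; apply/flattenP.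
    exists [seq x^-1 * y | x <- F c k, y <- F c k].
      by apply/mapP; exists k; rewrite // mem_iota.
    by apply/allpairsP; exists (x, y).
  by rewrite !gmulfM !multV pxy mulVg eqxx.
- rewrite -(omE g); have /andP[om1 om_alt] := omr g; apply: pi_girth => //.
    apply/andP; split.
      by case: (om g) (omE g) => //= g1'; rewrite -g1' eqxx in g1.
    apply: leq_trans (leq_addl _ _).
    exact: (@leq_bigmax_seq _ _ xpredT (fun g => size (om g)) g (bP g lg) isT).
  apply/allP => -[c s] tom; apply: aP => /=; last exact: (allP om1 _ tom).
  rewrite mem_cat mem_pmap; apply/orP; left; apply/mapP.
  exists (existT _ c s).
    by apply/flattenP; exists (om g) => //; apply/mapP; exists g => //; exact: bP.
  by case: eqP => //= e; rewrite (eq_axiomK e).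
Qed.

Lemma coproduct_box_space_embeds : exists N : nat -> finIndexNormal G,
  [/\ (\bigcap_n (N n : set G) = [set 1%g])%classic,
      exists X : metricType R, is_box_space l N X &
      forall X : metricType R, is_box_space l N X ->
        coarsely_embeds_into_hilbert X].
Proof.
have [l0 lD lV l1] := len_length l.
pose Kp n := projT1 (cid (good_quotient_exists n)).
have KpP n : good_quotient n (Kp n) := projT2 (cid (good_quotient_exists n)).
pose pi n := projT2 (Kp n).
exists (fun n => cover_ker coprodG (pi n)); split.
- apply/seteqP; split=> g.
    move=> gN; apply: contrapT => /eqP g1.
    have [_ _] := KpP (Num.truncn (l g)).+1.
    move=> /(_ g (ltW (truncnS_gt _)) g1) /eqP; apply.
    apply: (@cover_ker_pi _ _ _ coprodG); exact: (gN _ I).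
  by move=> -> n _; have [] := fin_subgroup (cover_ker coprodG (pi n)).
- exact: box_space_exists.
have [C CP] : exists C : letter S -> R, forall m t,
    (\sum_(k < m) (defect F k (tagged t))%:R / (#|` F (tag t) k|)%:R <= C t)%R.
  exists (fun t => projT1 (cid (defect_summable (tagged t)))) => m t.
  exact: (projT2 (cid (defect_summable (tagged t)))).
have [om omE] : exists om : G -> seq (letter S), forall g, wval i (om g) = g.
  exists (fun g => projT1 (cid (word_surj coprodG g))) => g.
  exact: (projT2 (cid (word_surj coprodG g))).
apply: (@box_space_embeds R G l _ (fun n => (bool * 'I_n.+1 * projT1 (Kp n))%type)
  (fun n => @wall_map R S G i coprodG (projT1 (Kp n)) (pi n) F n.+1)).
- by move=> n g h j Nh; exact: wall_map_ker.
- move=> t; have [B BP] := finite_ubound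
    (fun g => \sum_(t <- om g) (C t + C (mk_letter (tagged t)^-1)))%R (len_proper l t).
  exists B => n g h lgh; rewrite wall_map_dist -[(g^-1 * h)%g]omE.
  apply: le_trans (BP _ lgh).
  by apply: total_separation_word => t'; exact: CP.
- move=> s.
  (* A near letter is a quotient of two elements of this finite set, so its length is bounded
     independently of [n]. *)
  pose D := [set t : letter S | exists2 k, k < (Num.truncn s).+1 &
    tagged t \in F (tag t) k]%classic.
  have finD : finite_set D.
    pose sk k c := [seq mk_letter x | x <- F c k].
    apply: (@sub_finite_set _ _ [set` flatten [seq sk k true ++ sk k false |
      k <- iota 0 (Num.truncn s).+1]]%classic); last exact: finite_seq.
    move=> [c x] [k ks xF]; apply/flattenP; exists (sk k true ++ sk k false).
      by apply/mapP; exists k; rewrite // mem_iota.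
    rewrite mem_cat; apply/orP; case: c x xF => x xF; [left|right];
      by apply/mapP; exists x.
  have [M MP] := finite_ubound (fun t => l (letter_val i t)) finD.
  exists ((Num.truncn s)%:R * (`|M| + `|M|))%R, (Num.truncn s) => n g h sn.
  rewrite wall_map_dist => sep_s; have [girth_n inj_n _] := KpP n.
  have [w [sw near_w Nw]] := separation_lower girth_n sn
    (sn : Num.truncn s < n.+1) F0 Fn0 inj_n sep_s.
  exists ((g^-1 * h)^-1 * wval i w)%g => //; rewrite mulKVg.
  apply: (@le_trans _ _ ((size w)%:R * (`|M| + `|M|))%R); last first.
    by rewrite ler_wpM2r ?addr_ge0// ler_nat.
  elim: w near_w {sw Nw} => [|t w IHw] near_w.
    by rewrite /= mul0r (l1 1%g).2.
  rewrite /= -natr1 mulrDl mul1r addrC; apply: le_trans (lD _ _) _.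
  apply: lerD; last by apply: IHw => t' t'w; apply: near_w; rewrite inE t'w orbT.
  have [k ks [x [y [xF yF txy]]]] := near_w t (mem_head _ _).
  rewrite /letter_val txy gmulfM multV; apply: le_trans (lD _ _) _; rewrite lV.
  by apply: lerD; apply: le_trans (ler_norm M); apply: (MP (mk_letter _)); exists k.
Qed.

End Coproduct.


Local Open Scope classical_set_scope.

Theorem theorem1 (R : realType) (A B G : groupType)
    (iA : {multiplicative A -> G}) (iB : {multiplicative B -> G})
    (l : properLength R G)
    (fgA : finitely_generated A) (fgB : finitely_generated B)
    (rfA : residually_finite A) (rfB : residually_finite B)
    (freeG : is_free_product iA iB)
    (amA : amenable R A) (amB : amenable R B) :
  exists N : nat -> finIndexNormal G,
  [/\ \bigcap_n (N n : set G) = [set 1%g],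
      exists X : metricType R, is_box_space l N X &
      forall X : metricType R, is_box_space l N X ->
        coarsely_embeds_into_hilbert X].
Proof.
pose S c : groupType := if c then A else B.
pose i c : {multiplicative S c -> G} :=
  match c return {multiplicative S c -> G} with true => iA | false => iB end.
have coprodG : is_coproduct i.
  move=> K f; have [h [hA hB h_uniq]] := freeG K (f true) (f false).
  exists h; split; first by case=> s; [exact: hA|exact: hB].
  by move=> h' h'E; apply: h_uniq => s; [exact: (h'E true)|exact: (h'E false)].
have amS c : amenable R (S c) by case: c.
have rfS c : residually_finite (S c) by case: c.
have [F [F0 Fn0 F_folner]] := folner_sequence coprodG l amS.
exact: (coproduct_box_space_embeds coprodG rfS F0 Fn0 F_folner).
Qed.
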